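(* Let $n\ge 1$ and let $G_n$ be the semisimple graph obtained as a join of $n$ copies of $K_1^\circ\cup K_1^\circ$. The (symmetric) generic completion rank of $G_n$ is $$\operatorname{sgcr}(G_n)=2n-\left\lfloor\tfrac12\left(\sqrt{1+8n}-1\right)\right\rfloor,$$ or equivalently, $\operatorname{sgcr}(G_n)=2n-k$ where $k$ is the largest integer such that $\binom{k+1}{2}\le n$. Moreover, every integer between $\operatorname{sgcr}(G_n)$ and $2n$ (inclusive) is a (symmetric) typical completion rank of $G_n$.
   Context: A semisimple graph $G=(V,E)$ is a finite graph in which loops, but no multiple edges, are allowed. A $G$-partial (symmetric) matrix over a field $K$ is an element $X\in K^E$; the entry for the edge $\{i,j\}$ (or the loop at $i=j$) specifies the $(i,j)$ and $(j,i)$ entries. A completion of $X$ over $K$ is a symmetric $|V|\times|V|$ matrix over $K$, rows and columns indexed by $V$, with the prescribed specified entries. The $K$-completion rank of $X$ is the minimum rank of a symmetric completion over $K$. The generic completion rank $\operatorname{sgcr}(G)$ is the unique integer that is the complex completion rank of all $X$ in some nonempty Zariski-open subset of $\mathbb{C}^E$. An integer $r$ is a typical completion rank of $G$ if the set of $X\in\mathbb{R}^E$ with real completion rank $r$ has nonempty interior in the Euclidean topology. $K_1^\circ$ is a single vertex with a loop, and $K_1^\circ\cup K_1^\circ$ is the disjoint union of two of these. The join of graphs $G_1=(V_1,E_1)$, $G_2=(V_2,E_2)$ on disjoint vertex sets is $(V_1\cup V_2,E_1\cup E_2\cup E)$, where $E$ consists of all edges $\{v_1,v_2\}$ with $v_1\in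 V_1$, $v_2\in V_2$. Thus $G_n$ has $2n$ vertices, all loops, and all edges except for a perfect matching; up to simultaneous permutation of rows and columns, $G_n$-partial matrices are $2n\times 2n$ symmetric matrices with exactly the antidiagonal unspecified. *)

(* Defs.v *)
From HB Require Import structures.
From mathcomp Require Import all_boot all_order all_algebra.
From mathcomp Require Import mpoly complex.
From mathcomp Require Import boolp classical_sets reals topology normedtype.

Set Implicit Arguments.
Unset Strict Implicit.
Unset Printing Implicit Defensive.

Import Order.TTheory GRing.Theory Num.Theory numFieldNormedType.Exports.
Local Open Scope ring_scope.
Local Open Scope complex_scope.

(* Semisimple graphs: a symmetric relation allows loops and excludes multiple
   edges. *)
Record sgraph := SGraph {
  vert :> finType;
  adj : rel vert;
  adj_sym : ssrbool.symmetric adj }.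

(* Edges are unordered pairs; a loop at i is the singleton [set i; i]. *)
Definition edges (G : sgraph) : {set {set G}} :=
  [set [set p.1; p.2] | p in [pred p : G * G | adj p.1 p.2]]%SET.

Definition looped_vertex_adj : rel unit := fun _ _ => true.

Lemma looped_vertex_sym : ssrbool.symmetric looped_vertex_adj.
Proof. by []. Qed.

Definition looped_vertex : sgraph := SGraph looped_vertex_sym.

Section UnionJoin.
Variables G H : sgraph.

Definition union_adj : rel (G + H)%type := fun x y =>
  match x, y with
  | inl i, inl j => adj i j
  | inr i, inr j => adj i j
  | _, _ => false
  end.

Lemma union_adj_sym : ssrbool.symmetric union_adj.
Proof. by case=> i [] j //=; apply: adj_sym. Qed.

Definition gunion : sgraph := SGraph union_adj_sym.

Definition join_adj : rel (G + H)%type := fun x y =>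
  match x, y with
  | inl i, inl j => adj i j
  | inr i, inr j => adj i j
  | _, _ => true
  end.

Lemma join_adj_sym : ssrbool.symmetric join_adj.
Proof. by case=> i [] j //=; apply: adj_sym. Qed.

Definition gjoin : sgraph := SGraph join_adj_sym.

End UnionJoin.

(* The join of n copies of G, for n >= 1 (the value at 0 is junk). *)
Definition join_copies (n : nat) (G : sgraph) : sgraph := iter n.-1 (gjoin G) G.

Definition G_ (n : nat) : sgraph :=
  join_copies n (gunion looped_vertex looped_vertex).

(* K^E: the k-th coordinate is the entry at the edge [enum_val k]. *)
Notation partial_matrix K G := 'rV[K]_#|edges G|.

Section Completion.
Variables (K : fieldType) (G : sgraph).

(* The row and column of a vertex i have index [enum_rank i]. *)
Definition completion (X : partial_matrix K G) (M : 'M[K]_#|G|) : Prop :=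
  M^T = M /\
  forall (k : 'I_#|edges G|) (i j : G), enum_val k = [set i; j]%SET ->
    M (enum_rank i) (enum_rank j) = X ord0 k.

Definition completion_rank (X : partial_matrix K G) (r : nat) : Prop :=
  (exists2 M, completion X M & \rank M = r) /\
  (forall M, completion X M -> (r <= \rank M)%N).

End Completion.

Definition zariski_open (K : fieldType) (m : nat) (U : set 'rV[K]_m) : Prop :=
  exists S : set {mpoly K[m]},
    forall x, U x <-> exists2 p, S p & p.@[fun k => x ord0 k] != 0.

Section GenericTypical.
Variables (R : realType) (G : sgraph).

(* [r] is the complex completion rank on some nonempty Zariski-open set, and is
   the only such integer; complex numbers are R[i]. *)
Definition is_sgcr (r : nat) : Prop :=
  unique (fun s => exists U : set (partial_matrix R[i] G),
    [/\ zariski_open U, (U !=set0)%classic &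
        forall X, U X -> completion_rank X s]) r.

(* The topology on matrices over R is the product (Euclidean) one. *)
Definition typical_rank (r : nat) : Prop :=
  (([set X : partial_matrix R G | completion_rank X r]°) !=set0)%classic.

End GenericTypical.

(* Main.v *)
Require Import Defs.
From mathcomp Require Import all_boot all_order all_algebra closed_field.
From mathcomp Require Import mpoly complex ordered_qelim qe_rcf zify ring lra.
From mathcomp Require Import boolp classical_sets reals topology normedtype realfun.

(** A [G_ n]-partial matrix is, up to a permutation of the vertices, a symmetric
    2n x 2n matrix in which only the n entries joining vertex [i] of the first
    half to vertex [i] of the second half are free. Write a rank as [2n - j]. The
    space of symmetric matrices of rank at most [2n - j] has codimension
    [C(j+1, 2)], so that a generic partial matrix should have a completion of
    that rank exactly when the [n] free entries can absorb [C(j+1, 2)] equations,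
    that is, when [C(j+1, 2) <= n]. The proof makes both directions precise.

    Suppose [n < C(j+1, 2)]. A symmetric matrix of rank [r] is [C S C^T] with [S]
    symmetric of size [r] and with an identity block in [C]; so the matrices of
    rank at most [2n - j] are covered by finitely many polynomial maps in fewer
    variables than there are edges. More polynomials than variables are
    algebraically dependent ([mpoly_alg_dependent]), hence a nonzero polynomial
    vanishes on all partial matrices completable to rank at most [2n - j]
    ([rank_le_not_dense]).

    Suppose [C(j+1, 2) <= n]. Let [M0] be symmetric of rank [2n - j] and let the
    two rows [i] of a basis [Z] of its kernel be the linear forms [p_i] and [q_i].
    The tangent directions to the matrices of bounded rank at [M0] are the
    symmetric [A] with [Z^T A Z = 0] ([rank_tangent_space]), and the free entries
    contribute the products [p_i q_i] to [Z^T A Z]. If these products span all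
    quadratic forms in [j] variables, which [n] products can do
    ([spanning_products]), then every direction in the space of partial matrices
    is the velocity of a curve of partial matrices completable to rank at most
    [2n - j]. A nonzero polynomial cannot vanish along all these curves
    ([mpoly_curve]): these partial matrices are Zariski dense, and so are those
    close to the specified part of [M0] ([low_rank_dense]). Over the reals one
    moreover takes [M0] positive definite on the first half of the coordinates
    and negative definite on an [n - j] dimensional space in the second half.
    Both diagonal blocks are entirely specified, so this persists in every
    completion of every nearby partial matrix and keeps its rank at least
    [2n - j] ([model_rank_stable]). So partial matrices of real completion rank
    exactly [2n - j] are Zariski dense.

    It remains to pass from dense sets to open ones. Having a given completion
    rank is a first-order property of the specified entries. By quantifier
    elimination it is a boolean combination of polynomial equations over the
    complex numbers, and of equations and inequalities over the reals. Away from
    the zeros of the product [L] of the nonzero polynomials involved, its truth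
    value is constant in the first case ([closed_definable_generic]) and locally
    constant in the second one ([real_definable_interior]). A dense definable set
    meets the complement of the zeros of [L], and therefore contains a nonempty
    Zariski open set, respectively has an interior point. *)

Set Implicit Arguments.
Unset Strict Implicit.
Unset Printing Implicit Defensive.
Import Order.TTheory GRing.Theory Num.Theory numFieldNormedType.Exports.
Local Open Scope ring_scope.

Notation "p .[: x ]" := (meval (fun k => fun_of_matrix x ord0 k) p)
  (at level 2, left associativity, format "p .[:  x ]") : ring_scope.

(** * Polynomials in several variables *)

Lemma base_expansion_inj (B n : nat) (a b : 'I_n -> nat) :
  (forall i, (a i < B)%N) -> (forall i, (b i < B)%N) ->
  (\sum_i a i * B ^ i = \sum_i b i * B ^ i)%N -> a =1 b.
Proof.
elim: n a b => [|n IHn] a b ltaB ltbB; first by move=> _ [].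
rewrite !big_ord_recl /= expn0 !muln1.
have shift (c : 'I_n.+1 -> nat) : (\sum_(i < n) c (lift ord0 i) * B ^ bump 0 i
   = (\sum_(i < n) c (lift ord0 i) * B ^ i) * B)%N.
  rewrite big_distrl; apply: eq_bigr => i _ /=.
  by rewrite /bump leq0n add1n expnSr mulnA.
rewrite !shift => eq_ab.
have B_gt0 : (0 < B)%N by apply: leq_trans (ltaB ord0).
have eq0 : a ord0 = b ord0.
  by move/(congr1 (modn^~ B)): (eq_ab); rewrite ![(_ + _ * B)%N]addnC !modnMDl !modn_small.
have /IHn eqS : (\sum_(i < n) a (lift ord0 i) * B ^ i
                 = \sum_(i < n) b (lift ord0 i) * B ^ i)%N.
  move: eq_ab; rewrite eq0 => /addnI /eqP; rewrite eqn_pmul2r // => /eqP; exact.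
move=> i; case: (unliftP ord0 i) => [j ->|->] //.
by apply: eqS.
Qed.

Lemma poly_nonroot (K : numFieldType) (g : {poly K}) (e : K) :
  g != 0 -> 0 < e -> exists2 x, 0 < x <= e & g.[x] != 0.
Proof.
move=> g_neq0 e_gt0; pose s := [seq e / i.+1%:R | i <- iota 0 (size g)].
have uniq_s : uniq s.
  rewrite map_inj_uniq ?iota_uniq // => i j /(mulfI (lt0r_neq0 e_gt0)).
  by move/invr_inj/eqP; rewrite eqr_nat eqSS => /eqP.
have [roots_s|/allPn[_ /mapP[i _ ->] nroot_i]] := boolP (all (root g) s).
  by have := max_poly_roots g_neq0 roots_s uniq_s; rewrite size_map size_iota ltnn.
exists (e / i.+1%:R) => //; rewrite divr_gt0 ?ltr0n //=.
by rewrite ler_pdivrMr ?ltr0n // ler_peMr ?ler1n ?ltW.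
Qed.

(** Kronecker substitution: for [B] above the degree of [p], setting the [i]-th
    variable to [t ^ (B ^ i)] sends distinct monomials of [p] to distinct powers
    of [t], so that [p] becomes a nonzero polynomial in one variable. *)
Lemma mpoly_nonroot (K : numFieldType) n (p : {mpoly K[n]}) :
  p != 0 -> exists x : 'I_n -> K, p.@[x] != 0.
Proof.
move=> p_neq0; pose B := (msize p).+1.
pose code (m : 'X_{1..n}) := (\sum_i m i * B ^ i)%N.
pose g : {poly K} := \sum_(m <- msupp p) p@_m *: 'X^(code m).
have g_neq0 : g != 0.
  have supp_m0 := mlead_supp p_neq0; apply/eqP => /(congr1 (coefp (code (mlead p)))).
  rewrite /coefp coef0 coef_sum (bigD1_seq _ supp_m0) ?msupp_uniq //= coefZ coefXn.
  rewrite eqxx mulr1 big_seq_cond big1 ?addr0 => [/eqP|m /andP[supp_m neq_m]].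
    by rewrite mleadc_eq0 (negPf p_neq0).
  rewrite coefZ coefXn; case: eqP => [eq_c|_]; last by rewrite mulr0.
  case/eqP: neq_m; apply/mnmP; apply: (base_expansion_inj (B := B)) => // i.
    rewrite ltnS (leq_trans _ (ltnW (msize_mdeg_lt supp_m))) //.
    by rewrite mdegE (bigD1 i) //= leq_addr.
  rewrite ltnS (leq_trans _ (ltnW (msize_mdeg_lt supp_m0))) //.
  by rewrite mdegE (bigD1 i) //= leq_addr.
have [x _ nroot_x] := poly_nonroot g_neq0 (ltr01 : 0 < 1 :> K).
exists (fun i => x ^+ (B ^ i)); move: nroot_x; rewrite mevalE horner_sum.
congr (_ != 0); apply: eq_bigr => m _; rewrite hornerZ hornerXn; congr (_ * _).
rewrite -prodrXr; apply: eq_bigr => i _.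
by rewrite -exprM mulnC.
Qed.

(** If [y] is not a zero of the lowest homogeneous part of [p], of degree [d], then
    along any curve leaving the origin with velocity [y] the polynomial [p]
    vanishes to order exactly [d]; the acceleration [w] only affects higher
    orders. *)
Lemma mpoly_lowest_form (K : numFieldType) n (p : {mpoly K[n]}) : p != 0 ->
  exists d (y : 'I_n -> K), forall w : 'I_n -> K, exists2 h : {poly K},
    h.[0] != 0 &
    forall e, p.@[fun i => e * (y i + e * w i)] = e ^+ d * h.[e].
Proof.
move=> p_neq0.
have ex_d : exists d, has (fun m => mdeg m == d) (msupp p).
  by exists (mdeg (mlead p)); apply/hasP; exists (mlead p); rewrite ?mlead_supp.
pose d := ex_minn ex_d; pose q := pihomog mdeg d p.
have d_min m : m \in msupp p -> (d <= mdeg m)%N.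
  move=> supp_m; rewrite /d; case: ex_minnP => d' _; apply.
  by apply/hasP; exists m.
have /mpoly_nonroot[y qy_neq0] : q != 0.
  have /hasP[m supp_m /eqP deg_m] : has (fun m => mdeg m == d) (msupp p).
    by rewrite /d; case: ex_minnP.
  apply: contraTneq supp_m => /(congr1 (mcoeff m)); rewrite mcoeff0 /q pihomogE.
  rewrite raddf_sum /= => q_m; rewrite -mcoeff_eq0 -{}q_m.
  have [supp_m|/memN_msupp_eq0 p_m] := boolP (m \in msupp p).
    rewrite -big_filter (bigD1_seq m) ?filter_uniq ?msupp_uniq //=; last first.
      by rewrite mem_filter deg_m eqxx.
    rewrite mcoeffZ mcoeffX eqxx mulr1 big1 ?addr0 ?eqxx // => m' /negPf neq_m.
    by rewrite mcoeffZ mcoeffX neq_m mulr0.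
  rewrite p_m eq_sym big_seq_cond big1 // => m' /andP[supp_m' _].
  rewrite mcoeffZ mcoeffX; case: eqP => [eq_m|]; last by rewrite mulr0.
  by rewrite eq_m p_m mul0r.
exists d, y => w.
pose t (m : 'X_{1..n}) : {poly K} := \prod_i ((y i)%:P + w i *: 'X) ^+ m i.
exists (\sum_(m <- msupp p) p@_m *: ('X ^+ (mdeg m - d) * t m)).
  move: qy_neq0; rewrite /q pihomogE raddf_sum /= horner_sum big_mkcond /=.
  congr (_ != 0); rewrite !big_seq; apply: eq_bigr => m supp_m.
  rewrite hornerZ hornerM hornerXn horner_prod; case: eqP => [->|/eqP neq_d].
    rewrite subnn mul1r mevalZ mevalX; congr (_ * _); apply: eq_bigr => i _.
    by rewrite horner_exp !hornerE.
  by rewrite expr0n subn_eq0 leqNgt ltn_neqAle eq_sym neq_d d_min // mul0r mulr0.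
move=> e; rewrite mevalE horner_sum mulr_sumr !big_seq; apply: eq_bigr => m supp_m.
rewrite hornerZ hornerM hornerXn mulrCA; congr (_ * _).
rewrite mulrA -exprD subnKC ?d_min // horner_prod mdegE.
rewrite -prodrXr -big_split /=; apply: eq_bigr => i _.
by rewrite horner_exp !hornerE exprMn [e * w i]mulrC.
Qed.

(** This is how Zariski density is proved below: a set that contains, for each
    velocity [y], points of some curve [x + e y + e^2 w] for infinitely many [e]
    cannot lie in a hypersurface. *)
Lemma mpoly_curve (K : numFieldType) n (p : {mpoly K[n]}) (x : 'I_n -> K) :
  p != 0 -> exists y : 'I_n -> K, forall w : 'I_n -> K, exists2 g : {poly K},
    g != 0 &
    forall e, p.@[fun i => x i + e * y i + e ^+ 2 * w i] = g.[e].
Proof.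
move=> p_neq0; pose q := p \mPo [tuple 'X_i + (x i)%:MP_[n] | i < n].
have qE z : q.@[z] = p.@[fun i => x i + z i].
  rewrite comp_mpoly_meval; apply: meval_eq => i.
  by rewrite tnth_mktuple mevalD mevalXU mevalC addrC.
have /mpoly_lowest_form[d [y hP]] : q != 0.
  have [z pz_neq0] := mpoly_nonroot p_neq0.
  apply: contraNneq pz_neq0 => q0; have := qE (fun i => z i - x i).
  rewrite q0 meval0 => pz0; rewrite {1}pz0; apply/eqP/meval_eq => i.
  by rewrite addrC subrK.
exists y => w; have [h h0 hE] := hP w.
exists ('X ^+ d * h) => [|e].
  by rewrite mulf_neq0 ?expf_neq0 ?polyX_eq0 //; apply: contraNneq h0 => ->; rewrite horner0.
rewrite hornerM hornerXn -hE qE; apply: meval_eq => i.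
by rewrite mulrDr addrA mulrA expr2.
Qed.

Lemma msizeM_leS (R : idomainType) n (p q : {mpoly R[n]}) a b :
  (msize p <= a.+1)%N -> (msize q <= b.+1)%N -> (msize (p * q) <= (a + b).+1)%N.
Proof.
have [->|p_neq0] := eqVneq p 0; first by rewrite mul0r msize0.
have [->|q_neq0] := eqVneq q 0; first by rewrite mulr0 msize0.
rewrite msizeM // => le_p le_q; have := leq_add le_p le_q.
by rewrite addSn addnS -subn1 leq_subLR add1n.
Qed.

Lemma msizeX_leS (R : idomainType) n (p : {mpoly R[n]}) a k :
  (msize p <= a.+1)%N -> (msize (p ^+ k) <= (a * k).+1)%N.
Proof.
move=> le_p; elim: k => [|k IHk]; first by rewrite muln0 expr0 msize1.
by rewrite exprS mulnS msizeM_leS.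
Qed.

(** Monomials are counted: the [(d + 1) ^ m] monomials of degree at most [d] in
    each of [m] variables become, after substitution of the [f i], polynomials in
    [p] variables of degree [O(d)], which form a space of dimension [O(d ^ p)]. As
    [p < m], for large [d] they are linearly dependent. *)
Lemma mpoly_alg_dependent (K : fieldType) (p m : nat) (f : 'I_m -> {mpoly K[p]}) :
  (p < m)%N ->
  exists2 P : {mpoly K[m]}, P != 0 &
    forall x : 'I_p -> K, P.@[fun i => (f i).@[x]] = 0.
Proof.
move=> lt_pm; pose D := (\max_i msize (f i))%N.
(* The degrees after substitution are at most [b], and [d] is large enough for
   [b.+1 ^ p < d.+1 ^ m]. *)
pose d := ((m * D).+1 ^ p)%N; pose b := (m * D * d)%N.
pose I := {ffun 'I_m -> 'I_d.+1}; pose J := {ffun 'I_p -> 'I_b.+1}.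
pose mon (e : I) : 'X_{1..m} := [multinom (e i : nat) | i < m].
pose mon' (e : J) : 'X_{1..p} := [multinom (e i : nat) | i < p].
pose F (e : I) := \prod_i f i ^+ e i.
have size_F e : (msize (F e) <= b.+1)%N.
  have: (msize (F e) <= (\sum_(i < m) D * d).+1)%N.
    rewrite /F; elim/big_rec2: _ => [|i a q _ IHq]; first by rewrite msize1.
    apply: msizeM_leS => //; apply: (@leq_trans (D * e i).+1).
      by apply: msizeX_leS; rewrite leqW // /D leq_bigmax.
    by rewrite ltnS leq_mul2l -ltnS ltn_ord orbT.
  by rewrite sum_nat_const card_ord mulnA.
have lt_JI : (#|J| < #|I|)%N.
  rewrite !card_ffun !card_ord.
  have le_b : (b.+1 <= (m * D).+1 * d.+1)%N.
    rewrite /b mulSn addSn ltnS (leq_trans _ (leq_addl _ _)) //.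
    by rewrite leq_mul2l leqnSn orbT.
  apply: (@leq_ltn_trans ((m * D).+1 ^ p * d.+1 ^ p)%N).
    by rewrite -expnMn; case: (p) => // p'; rewrite leq_exp2r.
  apply: (@leq_trans (d.+1 ^ p.+1)%N); last by rewrite leq_pexp2l.
  by rewrite expnS ltn_pmul2r ?expn_gt0.
pose A := \matrix_(i < #|I|, j < #|J|) (F (enum_val i))@_(mon' (enum_val j)).
have kerA_neq0 : kermx A != 0.
  rewrite kermx_eq0 /row_free neq_ltn (leq_ltn_trans _ lt_JI) //.
  exact: rank_leq_col.
pose v := nz_row (kermx A).
have v_neq0 : v != 0 by rewrite nz_row_eq0.
have vA0 : v *m A = 0 by apply/sub_kermxP; apply: nz_row_sub.
have sumF0 : \sum_i v ord0 i *: F (enum_val i) = 0.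
  apply/mpolyP => mu; rewrite mcoeff0 raddf_sum /=.
  have [le_mu|] := boolP [forall k, (mu k <= b)%N].
    pose e : J := [ffun k => inord (mu k)].
    have /rowP/(_ (enum_rank e)) := vA0; rewrite !mxE => vAe.
    rewrite -[RHS]vAe; apply: eq_bigr => i _; rewrite mcoeffZ !mxE enum_rankK.
    congr (_ * mcoeff _ _); apply/mnmP => k; rewrite mnmE ffunE inordK // ltnS.
    exact: (forallP le_mu).
  rewrite negb_forall => /existsP[k]; rewrite -ltnNge => lt_mu.
  apply: big1 => i _; rewrite mcoeffZ memN_msupp_eq0 ?mulr0 //.
  apply: msize_mdeg_ge; apply: (leq_trans (size_F _)); apply: (leq_trans lt_mu).
  by rewrite mdegE (bigD1 k) //= leq_addr.
exists (\sum_i v ord0 i *: 'X_[mon (enum_val i)]) => [|x].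
  have /rV0Pn[i0 v_i0] := v_neq0.
  apply: contraNneq v_i0 => /(congr1 (mcoeff (mon (enum_val i0)))).
  rewrite mcoeff0 raddf_sum /= (bigD1 i0) //= mcoeffZ mcoeffX eqxx mulr1.
  rewrite big1 ?addr0 => [->//|i neq_i]; rewrite mcoeffZ mcoeffX.
  case: eqP => [/mnmP eq_mon|_]; last by rewrite mulr0.
  case/eqP: neq_i; apply: enum_val_inj; apply/ffunP => k; apply: val_inj.
  by have := eq_mon k; rewrite !mnmE.
have := congr1 (meval x) sumF0; rewrite meval0 !raddf_sum => sum0.
rewrite -[RHS]sum0; apply: eq_bigr => i _ /=.
rewrite !mevalZ mevalX; congr (_ * _); rewrite rmorph_prod; apply: eq_bigr => k _.
by rewrite mnmE rmorphXn.
Qed.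

(** * Definable sets are generically open *)

Section TermsAsPolynomials.
Variables (K : fieldType) (m : nat).

Definition env (x : 'rV[K]_m) : seq K := [seq x ord0 i | i <- enum 'I_m].

Lemma size_env x : size (env x) = m.
Proof. by rewrite size_map size_enum_ord. Qed.

Lemma nth_env x (i : 'I_m) : nth 0 (env x) i = x ord0 i.
Proof. by rewrite (nth_map i) ?size_enum_ord // nth_ord_enum. Qed.

(** The inverse is sent to [0]: only terms in the language of rings, recognized by
    [GRing.rterm], are translated faithfully. *)
Fixpoint mpoly_of_term (t : GRing.term K) : {mpoly K[m]} :=
  match t with
  | GRing.Var i => if insub i is Some k then 'X_k else 0
  | GRing.Const c => c%:MP
  | GRing.NatConst n => n%:R
  | GRing.Add t1 t2 => mpoly_of_term t1 + mpoly_of_term t2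
  | GRing.Opp t1 => - mpoly_of_term t1
  | GRing.NatMul t1 n => mpoly_of_term t1 *+ n
  | GRing.Mul t1 t2 => mpoly_of_term t1 * mpoly_of_term t2
  | GRing.Inv _ => 0
  | GRing.Exp t1 n => mpoly_of_term t1 ^+ n
  end.

Lemma meval_term t (x : 'rV[K]_m) : GRing.rterm t ->
  (mpoly_of_term t).[: x ] = GRing.eval (env x) t.
Proof.
elim: t => //=.
- move=> i _; case: insubP => [k _ <-|]; first by rewrite mevalXU nth_env.
  by rewrite -leqNgt => le_mi; rewrite meval0 nth_default ?size_env.
- by move=> c _; rewrite mevalC.
- by move=> n _; rewrite rmorph_nat.
- by move=> t1 IH1 t2 IH2 /andP[/IH1 <- /IH2 <-]; rewrite mevalD.
- by move=> t1 IH1 /IH1 <-; rewrite mevalN.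
- by move=> t1 IH1 n /IH1 <-; rewrite mevalMn.
- by move=> t1 IH1 t2 IH2 /andP[/IH1 <- /IH2 <-]; rewrite mevalM.
- by move=> t1 IH1 n /IH1 <-; rewrite rmorphXn.
Qed.

Lemma eval_eq_meval t1 t2 (x : 'rV[K]_m) : GRing.rterm t1 -> GRing.rterm t2 ->
  (GRing.eval (env x) t1 == GRing.eval (env x) t2) =
  ((mpoly_of_term t1 - mpoly_of_term t2).[: x ] == 0).
Proof. by move=> r1 r2; rewrite mevalB !meval_term // subr_eq0. Qed.

Definition generically_constant (b : 'rV[K]_m -> bool) : Prop :=
  exists2 L : {mpoly K[m]}, L != 0 &
    forall x y : 'rV[K]_m, L.[: x ] != 0 -> L.[: y ] != 0 -> b x = b y.

(** The polynomial attached to a boolean combination is the product of those of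
    its parts; this needs the ring of polynomials to be a domain. *)
Lemma generically_constant2 (op : bool -> bool -> bool) b1 b2 :
  generically_constant b1 -> generically_constant b2 ->
  generically_constant (fun x => op (b1 x) (b2 x)).
Proof.
move=> [L1 nz1 H1] [L2 nz2 H2]; exists (L1 * L2); first by rewrite mulf_neq0.
move=> x y; rewrite !mevalM !mulf_eq0 !negb_or => /andP[x1 x2] /andP[y1 y2].
by rewrite (H1 x y) // (H2 x y).
Qed.

(** Away from the zeros of [L], every nonzero polynomial compared to [0] in the
    formula is nonzero, which settles all its atoms. *)
Lemma qf_generically_constant (f : GRing.formula K) :
  GRing.qf_form f && GRing.rformula f ->
  generically_constant (fun x => GRing.qf_eval (env x) f).
Proof.
elim: f => //=.
- by move=> b _; exists 1 => //; apply: oner_neq0.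
- move=> t1 t2 /andP[r1 r2]; pose p := mpoly_of_term t1 - mpoly_of_term t2.
  have [p0|p_neq0] := eqVneq p 0.
    exists 1; first exact: oner_neq0.
    by move=> x y _ _; rewrite !eval_eq_meval // -/p p0 !meval0.
  by exists p => // x y px py; rewrite !eval_eq_meval // (negPf px) (negPf py).
- move=> f1 IH1 f2 IH2; rewrite andbACA => /andP[/IH1 ? /IH2 ?].
  exact: (generically_constant2 andb).
- move=> f1 IH1 f2 IH2; rewrite andbACA => /andP[/IH1 ? /IH2 ?].
  exact: (generically_constant2 orb).
- move=> f1 IH1 f2 IH2; rewrite andbACA => /andP[/IH1 ? /IH2 ?].
  exact: (generically_constant2 implb).
- move=> f1 IH1 /IH1[L nzL HL]; exists L => // x y Lx Ly.
  by rewrite (HL x y).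
Qed.

End TermsAsPolynomials.

(** Over an algebraically closed field, quantifier elimination shows that a
    definable set either contains or avoids a nonempty Zariski open set. This
    plays the role of Chevalley's theorem on images of polynomial maps. *)
Lemma closed_definable_generic (F : closedFieldType) m (f : GRing.formula F) :
  GRing.rformula f ->
  exists2 L : {mpoly F[m]}, L != 0 & forall x y : 'rV[F]_m,
    L.[: x ] != 0 -> L.[: y ] != 0 ->
    GRing.holds (env x) f -> GRing.holds (env y) f.
Proof.
move=> rf; have wf := @ClosedFieldQE.wf_ex_elim F.
have ok := ClosedFieldQE.holds_ex_elim (@GRing.solve_monicpoly F).
have [L nzL HL] := qf_generically_constant m (GRing.quantifier_elim_wf wf rf).
exists L => // x y Lx Ly; have fP e := GRing.quantifier_elim_rformP wf ok e rf.
by move=> /fP; rewrite (HL x y) // => /fP.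
Qed.

(** Quantifier elimination over real closed fields is about the richer language of
    ordered rings. *)
Fixpoint ord_formula (T : Type) (f : GRing.formula T) : ord.formula T :=
  match f with
  | GRing.Bool b => ord.Bool b
  | GRing.Equal t1 t2 => ord.Equal t1 t2
  | GRing.Unit t => ord.Unit t
  | GRing.And f1 f2 => ord.And (ord_formula f1) (ord_formula f2)
  | GRing.Or f1 f2 => ord.Or (ord_formula f1) (ord_formula f2)
  | GRing.Implies f1 f2 => ord.Implies (ord_formula f1) (ord_formula f2)
  | GRing.Not f1 => ord.Not (ord_formula f1)
  | GRing.Exists i f1 => ord.Exists i (ord_formula f1)
  | GRing.Forall i f1 => ord.Forall i (ord_formula f1)
  end.

Lemma ord_formulaP (R : realDomainType) e (f : GRing.formula R) :
  ord.holds e (ord_formula f) <-> GRing.holds e f.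
Proof.
elim: f e => //=.
- by move=> f1 IH1 f2 IH2 e; have := IH1 e; have := IH2 e; tauto.
- by move=> f1 IH1 f2 IH2 e; have := IH1 e; have := IH2 e; tauto.
- by move=> f1 IH1 f2 IH2 e; have := IH1 e; have := IH2 e; tauto.
- by move=> f1 IH1 e; have := IH1 e; tauto.
- by move=> i f1 IH1 e; split=> -[x /IH1]; exists x.
- by move=> i f1 IH1 e; split=> fx x; apply/IH1.
Qed.

Lemma rformula_ord (R : realDomainType) (f : GRing.formula R) :
  ord.rformula (ord_formula f) = GRing.rformula f.
Proof. by elim: f => //= f1 -> f2 ->. Qed.

Section RealQuantifierElimination.
Variables (R : realType) (m : nat).

Lemma meval_continuous (p : {mpoly R[m]}) :
  continuous (fun x : 'rV[R]_m => p.[: x ]).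
Proof.
have monomial_continuous (mu : 'X_{1..m}) :
    continuous (fun x : 'rV[R]_m => \prod_i x ord0 i ^+ mu i).
  apply: continuous_big => [|i _ y]; first exact: mul_continuous.
  apply: (@continuous_comp _ _ _ (fun z : 'rV[R]_m => z ord0 i) (fun t => t ^+ mu i)).
    exact: coord_continuous.
  exact: exprn_continuous.
apply: continuous_big => [|mu _ x]; first exact: add_continuous.
exact: (cvgM (cvg_cst _) (monomial_continuous mu x)).
Qed.

Lemma near_meval_gt0 (p : {mpoly R[m]}) (x : 'rV[R]_m) :
  0 < p.[: x ] -> \forall y \near x, 0 < p.[: y ].
Proof. move=> p_gt0; exact: (cvgr_gt _ (@meval_continuous p x) _ p_gt0). Qed.

Lemma near_meval_sign (p : {mpoly R[m]}) (x : 'rV[R]_m) :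
  p.[: x ] != 0 -> \forall y \near x,
    (0 < p.[: y ]) = (0 < p.[: x ]) /\ p.[: y ] != 0.
Proof.
rewrite neq_lt => /orP[p_lt0|p_gt0].
  have /near_meval_gt0 : 0 < (- p).[: x ] by rewrite mevalN oppr_gt0.
  apply: filterS => y; rewrite mevalN oppr_gt0 => py_lt0.
  by rewrite !ltNge !ltW //= neq_lt py_lt0.
have := near_meval_gt0 p_gt0; apply: filterS => y py_gt0.
by rewrite p_gt0 py_gt0 neq_lt py_gt0 orbT.
Qed.

Definition generically_locally_constant (b : 'rV[R]_m -> bool) : Prop :=
  exists2 L : {mpoly R[m]}, L != 0 &
    forall x : 'rV[R]_m, L.[: x ] != 0 -> \forall y \near x, b y = b x.

Lemma generically_locally_constant2 (op : bool -> bool -> bool) b1 b2 :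
  generically_locally_constant b1 -> generically_locally_constant b2 ->
  generically_locally_constant (fun x => op (b1 x) (b2 x)).
Proof.
move=> [L1 nz1 H1] [L2 nz2 H2]; exists (L1 * L2); first by rewrite mulf_neq0.
move=> x; rewrite mevalM mulf_eq0 negb_or => /andP[/H1 x1 /H2 x2].
by apply: filterS2 x1 x2 => y -> ->.
Qed.

(** The hypothesis on [op] says that [op a b] only depends on the sign of [a - b]:
    it covers equality and both order relations at once. *)
Lemma comparison_locally_constant t1 t2 (op : R -> R -> bool) :
  GRing.rterm t1 && GRing.rterm t2 ->
  (forall a b c d : R, (0 < a - b) = (0 < c - d) ->
     (a - b == 0) = (c - d == 0) -> op a b = op c d) ->
  generically_locally_constant
    (fun x => op (GRing.eval (env x) t1) (GRing.eval (env x) t2)).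
Proof.
move=> /andP[r1 r2] opP; pose p := mpoly_of_term m t1 - mpoly_of_term m t2.
have pE x : GRing.eval (env x) t1 - GRing.eval (env x) t2 = p.[: x ].
  by rewrite mevalB !meval_term.
have [p0|p_neq0] := eqVneq p 0.
  exists 1 => [|x _]; first exact: oner_neq0.
  by apply: filterE => y; apply: opP; rewrite !pE p0 !meval0.
exists p => // x px; have := near_meval_sign px; apply: filterS => y [ltE py].
by apply: opP; rewrite !pE // (negPf px) (negPf py).
Qed.

Lemma qf_locally_constant (f : ord.formula R) :
  ord.qf_form f && ord.rformula f ->
  generically_locally_constant (fun x => ord.qf_eval (env x) f).
Proof.
elim: f => //=.
- by move=> b _; exists 1 => [|x _]; [exact: oner_neq0 | exact: filterE].
- move=> t1 t2 /comparison_locally_constant; apply => a b c d _.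
  by rewrite !subr_eq0.
- move=> t1 t2 /comparison_locally_constant; apply => a b c d ltE eqE.
  rewrite -subr_lt0 -[RHS]subr_lt0 !ltNge !le_eqVlt ltE.
  by rewrite [0 == a - b]eq_sym [0 == c - d]eq_sym eqE.
- move=> t1 t2 /comparison_locally_constant; apply => a b c d ltE eqE.
  by rewrite -subr_le0 -[RHS]subr_le0 !leNgt ltE.
- move=> f1 IH1 f2 IH2; rewrite andbACA => /andP[/IH1 ? /IH2 ?].
  exact: (generically_locally_constant2 andb).
- move=> f1 IH1 f2 IH2; rewrite andbACA => /andP[/IH1 ? /IH2 ?].
  exact: (generically_locally_constant2 orb).
- move=> f1 IH1 f2 IH2; rewrite andbACA => /andP[/IH1 ? /IH2 ?].
  exact: (generically_locally_constant2 implb).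
- move=> f1 IH1 /IH1[L nzL HL]; exists L => // x /HL.
  by apply: filterS => y ->.
Qed.

(** The real counterpart of [closed_definable_generic]: off the zeros of [L], the
    signs of all polynomials in a quantifier-free form of [f] are locally constant.
    This plays the role of an implicit function theorem. *)
Lemma real_definable_interior (f : GRing.formula R) : GRing.rformula f ->
  exists2 L : {mpoly R[m]}, L != 0 & forall x : 'rV[R]_m,
    L.[: x ] != 0 ->
    GRing.holds (env x) f -> \forall y \near x, GRing.holds (env y) f.
Proof.
rewrite -rformula_ord => rf.
have ok e := ord.quantifier_elim_rformP (@wf_QE_wproj R) (@valid_QE_wproj R) e rf.
have [L nzL HL] := qf_locally_constant (ord.quantifier_elim_wf (@wf_QE_wproj R) rf).
exists L => // x /HL near_x /ord_formulaP /ok fx; apply: filterS near_x => y eq_f.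
by apply/ord_formulaP/ok; rewrite eq_f.
Qed.

End RealQuantifierElimination.

(** * Symmetric matrices with prescribed entries *)

Lemma rank_leP (K : fieldType) n (M : 'M[K]_n) r :
  (\rank M <= r)%N <-> exists L (U : 'M_(r, n)), M = L *m U.
Proof.
split=> [rkM|[L [U ->]]]; last by rewrite (leq_trans (mxrankM_maxl _ _)) ?rank_leq_col.
exists (col_ebase M *m pid_mx (\rank M)), (pid_mx (\rank M) *m row_ebase M).
by rewrite mulmxA -(mulmxA (col_ebase M)) pid_mx_id ?mulmx_ebase.
Qed.

Section PrescribedEntries.
Variables (K : fieldType) (N m : nat) (pos : 'I_m -> 'I_N * 'I_N).
Implicit Types (X : 'rV[K]_m) (M : 'M[K]_N).

Definition entries_at M : 'rV[K]_m := \row_k M (pos k).1 (pos k).2.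

Definition rank_le_completable (r : nat) X : Prop :=
  exists M : 'M[K]_N, [/\ M^T = M, entries_at M = X & (\rank M <= r)%N].

Lemma rank_le_completableW X r r' : (r <= r')%N ->
  rank_le_completable r X -> rank_le_completable r' X.
Proof. by move=> le_r [M [symM MX rkM]]; exists M; split=> //; apply: leq_trans le_r. Qed.

Lemma holds_big_and (I : finType) (F : I -> GRing.formula K) e :
  GRing.holds e (\big[GRing.And/GRing.Bool true]_i F i) <->
  forall i, GRing.holds e (F i).
Proof.
have: GRing.holds e (\big[GRing.And/GRing.Bool true]_(i <- index_enum I) F i) <->
      {in index_enum I, forall i, GRing.holds e (F i)}.
  elim: (index_enum I) => [|i s IHs]; first by rewrite big_nil; split.
  rewrite big_cons /=; split=> [[Fi /IHs Fs] j|Fs].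
    by rewrite inE => /predU1P[->//|/Fs].
  by split; [apply: Fs; rewrite inE eqxx|apply/IHs=> j sj; apply: Fs; rewrite inE sj orbT].
move=> ->; split=> Fs i; last by move=> _; apply: Fs.
by apply: Fs; rewrite mem_index_enum.
Qed.

Lemma rformula_big_and (I : finType) (F : I -> GRing.formula K) :
  (forall i, GRing.rformula (F i)) ->
  GRing.rformula (\big[GRing.And/GRing.Bool true]_i F i).
Proof. by move=> rF; elim/big_rec: _ => //= i f _ ->; rewrite rF. Qed.

(** A block of existential quantifiers over the variables following those of [x]
    amounts to extending the valuation by a vector. *)
Lemma holds_exists_env p (f : GRing.formula K) (x : 'rV[K]_m) :
  GRing.holds (env x) (foldr GRing.Exists f (iota m p)) <->
  exists y : 'rV[K]_p, GRing.holds (env (row_mx x y)) f.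
Proof.
rewrite -GRing.foldExistsP; split=> [[e' eq_e fe']|[y fy]]; last first.
  exists (env (row_mx x y)) => // i; rewrite !inE mem_iota negb_and -ltnNge -leqNgt.
  case/orP=> [lt_im|le_i]; last first.
    by rewrite !nth_default ?size_env // (leq_trans _ le_i) // leq_addr.
  rewrite (nth_env _ (Ordinal lt_im)).
  by rewrite (nth_env _ (lshift p (Ordinal lt_im))) row_mxEl.
exists (\row_j nth 0 e' (m + j)); apply: GRing.eq_holds fe' => i.
have [lt_i|le_i] := ltnP i (m + p); last first.
  rewrite [RHS]nth_default ?size_env // -eq_e; last first.
    by rewrite !inE mem_iota negb_and -leqNgt le_i orbT.
  by rewrite nth_default ?size_env // (leq_trans _ le_i) // leq_addr.
rewrite [RHS](nth_env _ (Ordinal lt_i)).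
case: (splitP (Ordinal lt_i)) => [j|j] /= def_i.
  rewrite (_ : Ordinal lt_i = lshift p j) ?row_mxEl; last exact: val_inj.
  rewrite def_i -eq_e ?nth_env // !inE mem_iota negb_and -ltnNge ltn_ord //.
rewrite (_ : Ordinal lt_i = rshift m j) ?row_mxEr ?mxE ?def_i //.
exact: val_inj.
Qed.

Section Formula.
Variable r : nat.

Definition left_var (i : 'I_N) (l : 'I_r) : nat :=
  rshift m (lshift (r * N) (mxvec_index i l)).
Definition right_var (l : 'I_r) (j : 'I_N) : nat :=
  rshift m (rshift (N * r) (mxvec_index l j)).

Definition product_entry i j : GRing.term K :=
  \big[GRing.Add/GRing.NatConst _ 0]_l
     GRing.Mul (GRing.Var _ (left_var i l)) (GRing.Var _ (right_var l j)).

(** Rank at most [r] is expressed by a factorization [L *m U] through dimension [r],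
    which avoids minors. The entries of [L] and [U] are the variables numbered from
    [m] on, the first [m] variables being the prescribed entries. *)
Definition factorization_formula : GRing.formula K :=
  GRing.And
    (\big[GRing.And/GRing.Bool true]_(p : 'I_N * 'I_N)
       GRing.Equal (product_entry p.1 p.2) (product_entry p.2 p.1))
    (\big[GRing.And/GRing.Bool true]_(k < m)
       GRing.Equal (product_entry (pos k).1 (pos k).2) (GRing.Var _ k)).

Definition rank_le_formula : GRing.formula K :=
  foldr GRing.Exists factorization_formula (iota m (N * r + r * N)).

Lemma rformula_rank_le : GRing.rformula rank_le_formula.
Proof.
have r_entry i j : GRing.rterm (product_entry i j).
  by rewrite /product_entry; elim/big_rec: _.
rewrite /rank_le_formula; elim: (iota _ _) => //=.
by apply/andP; split; apply: rformula_big_and => *; rewrite /= !r_entry.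
Qed.

Lemma eval_product_entry (x : 'rV[K]_m) (L : 'M_(N, r)) (U : 'M_(r, N)) i j :
  GRing.eval (env (row_mx x (row_mx (mxvec L) (mxvec U)))) (product_entry i j)
  = (L *m U) i j.
Proof.
rewrite mxE /product_entry; set e := env _.
rewrite (big_morph (GRing.eval e) (id1 := 0) (op1 := +%R)) //.
apply: eq_bigr => l _; rewrite [LHS]/(nth 0 e _ * nth 0 e _) /e.
rewrite (nth_env _ (rshift m (lshift (r * N) (mxvec_index i l)))).
rewrite (nth_env _ (rshift m (rshift (N * r) (mxvec_index l j)))).
by rewrite !row_mxEr row_mxEl !mxvecE.
Qed.

Lemma rank_le_formulaP X :
  GRing.holds (env X) rank_le_formula <-> rank_le_completable r X.
Proof.
rewrite holds_exists_env; split=> [[y]|[M [symM MX /rank_leP[L [U defM]]]]].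
  rewrite -[y]hsubmxK -[lsubmx y]vec_mxK -[rsubmx y]vec_mxK.
  set L := vec_mx _; set U := vec_mx _ => -[/holds_big_and symLU /holds_big_and specLU].
  exists (L *m U); split; last by apply/rank_leP; exists L, U.
    apply/matrixP => i j; have := symLU (j, i).
    by rewrite /= !eval_product_entry => symLU_ij; rewrite mxE.
  apply/rowP => k; rewrite mxE; have := specLU k.
  rewrite /= eval_product_entry => ->.
  by rewrite (nth_env _ (lshift _ k)) row_mxEl.
exists (row_mx (mxvec L) (mxvec U)); split.
  apply/holds_big_and => -[i j] /=.
  by rewrite !eval_product_entry -defM -[in LHS]symM mxE.
apply/holds_big_and => k /=; rewrite eval_product_entry -defM.
by rewrite (nth_env _ (lshift (N * r + r * N) k)) row_mxEl -MX mxE.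
Qed.

End Formula.

Definition min_rank_completable r X : Prop :=
  rank_le_completable r X /\ forall r', (r' < r)%N -> ~ rank_le_completable r' X.

Definition rank_eq_formula (r : nat) : GRing.formula K :=
  GRing.And (rank_le_formula r)
    (\big[GRing.And/GRing.Bool true]_(r' < r) GRing.Not (rank_le_formula r')).

Lemma rformula_rank_eq r : GRing.rformula (rank_eq_formula r).
Proof.
by rewrite /= rformula_rank_le rformula_big_and // => i; apply: rformula_rank_le.
Qed.

Lemma rank_eq_formulaP r X :
  GRing.holds (env X) (rank_eq_formula r) <-> min_rank_completable r X.
Proof.
rewrite /min_rank_completable -rank_le_formulaP; split=> -[le_r min_r]; split=> //.
  move=> r' lt_r' le_r'; have /holds_big_and/(_ (Ordinal lt_r')) := min_r.
  by apply; apply/rank_le_formulaP.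
by apply/holds_big_and => r' /rank_le_formulaP; apply: min_r.
Qed.

End PrescribedEntries.

(** An edge determines its ends up to their order, and a symmetric matrix does not
    see that order. *)
Lemma set2_eq (T : finType) (a b c d : T) : [set a; b]%SET = [set c; d]%SET ->
  (a = c /\ b = d) \/ (a = d /\ b = c).
Proof.
move=> eq_ab.
have /set2P[ac|ad] : a \in [set c; d]%SET by rewrite -eq_ab set21.
  have /set2P[bc|bd] : b \in [set c; d]%SET by rewrite -eq_ab set22.
    have /set2P[da|db] : d \in [set a; b]%SET by rewrite eq_ab set22.
      by left; split; rewrite // bc da ac.
    by left; split.
  by left; split.
have /set2P[bc|bd] : b \in [set c; d]%SET by rewrite -eq_ab set22.
  by right; split.
have /set2P[ca|cb] : c \in [set a; b]%SET by rewrite eq_ab set21.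
  by right; split; rewrite // bd ca ad.
by right; split.
Qed.

Section Ends.
Variable G : sgraph.

Lemma edge_has_ends (k : 'I_#|edges G|) :
  exists p : G * G, adj p.1 p.2 && (enum_val k == [set p.1; p.2]%SET).
Proof.
by have /imsetP[p adj_p ->] := enum_valP k; exists p; rewrite eqxx andbT.
Qed.

Definition edge_ends k : G * G := xchoose (edge_has_ends k).

Lemma edge_ends_adj k : adj (edge_ends k).1 (edge_ends k).2.
Proof. by have /andP[] := xchooseP (edge_has_ends k). Qed.

Lemma edge_endsE k : enum_val k = [set (edge_ends k).1; (edge_ends k).2]%SET.
Proof. by have /andP[_ /eqP] := xchooseP (edge_has_ends k). Qed.

End Ends.

Definition edge_pos (G : sgraph) (k : 'I_#|edges G|) : 'I_#|G| * 'I_#|G| :=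
  (enum_rank (edge_ends k).1, enum_rank (edge_ends k).2).

Lemma completionE (K : fieldType) (G : sgraph) (X : partial_matrix K G) M :
  completion X M <-> M^T = M /\ entries_at (@edge_pos G) M = X.
Proof.
split=> -[symM MX]; split=> //.
  by apply/rowP => k; rewrite mxE (MX k) // edge_endsE.
move=> k i j; rewrite edge_endsE -MX mxE /= => /set2_eq[[-> ->]//|[-> ->]].
by rewrite -[in RHS]symM mxE.
Qed.

Lemma completion_rankP (K : fieldType) (G : sgraph) (X : partial_matrix K G) r :
  completion_rank X r <-> min_rank_completable (@edge_pos G) r X.
Proof.
split=> [[[M /completionE[symM MX] rkM] min_r]|[[M [symM MX rkM] min_r]]].
  split=> [|r' lt_r' [N [symN NX rkN]]]; first by exists M; rewrite rkM.
  have /min_r le_r : completion X N by apply/completionE.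
  by have := leq_trans le_r rkN; rewrite leqNgt lt_r'.
have lb N : completion X N -> (r <= \rank N)%N.
  move=> /completionE[symN NX]; rewrite leqNgt; apply/negP => /min_r; apply.
  by exists N.
have XM : completion X M by apply/completionE.
by split=> //; exists M => //; apply/eqP; rewrite eqn_leq rkM lb.
Qed.

(** * Counting the parameters of symmetric matrices of bounded rank *)

Lemma triangular_double k : (2 * 'C(k.+1, 2) = k.+1 * k)%N.
Proof. by rewrite -(mul_bin_diag k.+1 1) bin1. Qed.

Lemma bin2D a b : ('C(a + b, 2) = 'C(a, 2) + 'C(b, 2) + a * b)%N.
Proof.
elim: b => [|b IHb]; first by rewrite addn0 bin0n muln0 !addn0.
by rewrite addnS !binS !bin1 IHb mulnS; lia.
Qed.

(** This type indexes both the entries of a symmetric matrix of size [j] and the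
    monomials of degree 2 in [j] variables. *)
Definition sorted_pair (j : nat) := {p : 'I_j * 'I_j | (p.1 <= p.2)%N}.

Lemma card_sorted_pair j : #|{: sorted_pair j}| = 'C(j.+1, 2).
Proof.
rewrite card_sig -sum1_card.
rewrite -(pair_big_dep xpredT (fun a b : 'I_j => (a <= b)%N) (fun _ _ => 1%N)) /=.
rewrite (exchange_big_dep xpredT) //= -bin2_sum big_mkord big_ord_recl add0n.
apply: eq_bigr => b _; rewrite sum1_card.
rewrite -[RHS]card_ord -(card_image (f := widen_ord (ltn_ord b))); last first.
  by move=> x y [] /val_inj.
apply: eq_card => a; rewrite -topredE /=; apply/idP/fintype.imageP => [le_ab|[x _ ->]].
  by exists (Ordinal (le_ab : (a < b.+1)%N)) => //; apply: val_inj.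
by have := ltn_ord x; rewrite ltnS.
Qed.

(** Choose [\rank M] independent rows of [M], with indices [f]. Then [M = C B], where
    [B] consists of these rows, and symmetry gives [B = S C^T], where [S] is the
    corresponding principal submatrix. *)
Lemma symmetric_rank_param (K : fieldType) N (M : 'M[K]_N) : M^T = M ->
  exists (f : 'I_(\rank M) -> 'I_N) C S,
    [/\ injective f, rowsub f C = 1%:M, S^T = S & M = C *m S *m C^T].
Proof.
move=> symM; pose f := maxrankfun M; pose B := rowsub f M.
have freeB : row_free B := maxrowsub_free M.
pose C := M *m pinvmx B.
have defM : M = C *m B by rewrite mulmxKpV // eq_maxrowsub.
have C_f : rowsub f C = 1%:M.
  by apply: (row_free_inj freeB); rewrite mul1mx mul_rowsub_mx -defM.
exists f, C, (rowsub f B^T); split=> //.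
- exact: maxrankfun_inj.
- by apply/matrixP => i j; rewrite !mxE; have /matrixP/(_ (f i) (f j)) := symM; rewrite mxE.
have eqB : B = rowsub f (B^T *m C^T) by rewrite -trmx_mul -defM symM.
by rewrite -mulmxA mul_rowsub_mx -eqB.
Qed.

Section DimensionCount.
Variables (K : fieldType) (N m : nat) (pos : 'I_m -> 'I_N * 'I_N).

(** The dimension of the space of symmetric matrices of size [N] and rank [r]: the
    entries of [S] and those of [C] outside its identity block. *)
Definition sym_rank_dim r := ('C(r.+1, 2) + r * (N - r))%N.

Lemma sym_rank_dim_le r r' : (r' <= r)%N -> (r <= N)%N ->
  (sym_rank_dim r' <= sym_rank_dim r)%N.
Proof.
elim: r => [|r IHr]; first by case: r'.
rewrite leq_eqVlt => /predU1P[->//|]; rewrite ltnS => /IHr{}IHr lt_rN.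
apply: leq_trans (IHr (ltnW lt_rN)) _; rewrite /sym_rank_dim.
rewrite [in leqRHS]binS bin1 -addnA leq_add2l.
by rewrite -(subnSK lt_rN) -mulnS leq_mul2r leqnSn orbT.
Qed.

(** In the chart of [symmetric_rank_param] given by [f], each entry of [C S C^T] is a
    polynomial in [sym_rank_dim r] parameters. *)
Lemma rank_chart_not_dense r (f : 'I_r -> 'I_N) : (r <= N)%N ->
  (sym_rank_dim r < m)%N -> injective f ->
  exists2 P : {mpoly K[m]}, P != 0 &
    forall (C : 'M_(N, r)) (S : 'M_r), rowsub f C = 1%:M -> S^T = S ->
      P.[: entries_at pos (C *m S *m C^T) ] = 0.
Proof.
move=> le_rN lt_m injf.
pose T := ({i | i \notin codom f} * 'I_r + sorted_pair r)%type.
have cardT : (#|{: T}| < m)%N.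
  rewrite card_sum card_prod card_sorted_pair card_ord card_sig addnC mulnC.
  rewrite -(leq_add2l 0) (leq_ltn_trans _ lt_m) // leq_add2l leq_mul2l.
  rewrite (_ : #|[pred i | i \notin codom f]| = (N - r)%N) ?leqnn ?orbT //.
  have := cardC (mem (codom f)); rewrite card_codom // !card_ord => cardN.
  apply: (@addnI r); rewrite subnKC // -[RHS]cardN; congr (_ + _)%N.
pose c i l : {mpoly K[#|{: T}|]} :=
  if insub i is Some i' then 'X_(enum_rank (inl (i', l) : T)) else (i == f l)%:R.
pose s a b : {mpoly K[#|{: T}|]} :=
  if insub (a, b) is Some t then 'X_(enum_rank (inr t : T)) else
  if insub (b, a) is Some t then 'X_(enum_rank (inr t : T)) else 0.
pose F k := \sum_b (\sum_a c (pos k).1 a * s a b) * c (pos k).2 b.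
have [P nzP PF0] := mpoly_alg_dependent F cardT.
exists P => // C S C_f symS.
pose v (t : T) := match t with
  | inl p => C (val p.1) p.2
  | inr ab => S (val ab).1 (val ab).2
  end.
rewrite -[RHS](PF0 (fun q => v (enum_val q))).
apply: meval_eq => k; rewrite mxE mxE raddf_sum /=; apply: eq_bigr => b _.
have cE i l : (c i l).@[fun q => v (enum_val q)] = C i l.
  rewrite /c; case: insubP => [i' _ <-|]; first by rewrite mevalXU enum_rankK.
  rewrite negbK => /codomP[l' ->]; rewrite rmorph_nat inj_eq //.
  by have /matrixP/(_ l' l) := C_f; rewrite !mxE => ->.
have sE a b' : (s a b').@[fun q => v (enum_val q)] = S a b'.
  rewrite /s; case: insubP => [t _ def_t|lt_ba].
    by rewrite mevalXU enum_rankK /= def_t.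
  case: insubP => [t _ def_t|]; last by rewrite -ltnNge => /ltnW; rewrite (negPf lt_ba).
  by rewrite mevalXU enum_rankK /= def_t /= -[in LHS]symS mxE.
rewrite mevalM cE [C^T _ _]mxE [in LHS]mxE; congr (_ * _).
by rewrite raddf_sum; apply: eq_bigr => a _ /=; rewrite mevalM cE sE.
Qed.

(** There are finitely many charts of rank at most [r], so the product of the
    polynomials vanishing on each of them can be taken. *)
Lemma rank_le_not_dense r : (r <= N)%N -> (sym_rank_dim r < m)%N ->
  exists2 P : {mpoly K[m]}, P != 0 &
    forall X, rank_le_completable pos r X -> P.[: X ] = 0.
Proof.
move=> le_rN lt_m.
have chart (r' : 'I_r.+1) (f : {ffun 'I_r' -> 'I_N}) :
  exists P : {mpoly K[m]}, P != 0 /\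
    (injective f -> forall (C : 'M_(N, r')) (S : 'M_r'),
       rowsub f C = 1%:M -> S^T = S -> P.[: entries_at pos (C *m S *m C^T) ] = 0).
  case: (boolP (injectiveb f)) => [/injectiveP injf|not_inj]; last first.
    by exists 1; split=> [|/injectiveP injf]; [exact: oner_neq0|rewrite injf in not_inj].
  have le_r' : (r' <= r)%N by rewrite -ltnS.
  have [||P nzP P0] := @rank_chart_not_dense r' f _ _ injf.
  - exact: leq_trans le_rN.
  - by apply: leq_ltn_trans lt_m; apply: sym_rank_dim_le.
  by exists P.
have {}chart (r' : 'I_r.+1) :
  exists P : {ffun 'I_r' -> 'I_N} -> {mpoly K[m]}, forall f, P f != 0 /\
    (injective f -> forall (C : 'M_(N, r')) (S : 'M_r'),
       rowsub f C = 1%:M -> S^T = S -> (P f).[: entries_at pos (C *m S *m C^T) ] = 0).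
  exact: fin_all_exists (chart r').
have [P PP] := fin_all_exists chart.
exists (\prod_r' \prod_f P r' f) => [|X [M [symM <- rkM]]].
  by apply/prodf_neq0 => r' _; apply/prodf_neq0 => f _; have [] := PP r' f.
have [f [C [S [injf C_f symS defM]]]] := symmetric_rank_param symM.
have lt_r : (\rank M < r.+1)%N by [].
pose f' : {ffun 'I_(Ordinal lt_r) -> 'I_N} := finfun f.
have /= [_ P0] := PP (Ordinal lt_r) f'.
rewrite rmorph_prod (bigD1 (Ordinal lt_r)) //= rmorph_prod (bigD1 f') //=.
rewrite {1}defM P0 ?mul0r // => [a b|]; first by rewrite !ffunE => /injf.
by rewrite -C_f; apply/matrixP => a b; rewrite !mxE ffunE.
Qed.

End DimensionCount.

(** * A low rank matrix with surjective tangent space *)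

(** With [G] a pseudo-inverse of [M0] and [Q = G M0], the matrix [V = 1 - Q] maps to
    the kernel of [M0], so [V^T A V = 0]. Expanding [A = (Q + V)^T A (Q + V)] leaves
    three terms, which [W] produces because [M0 G^T = Q^T]. *)
Lemma rank_tangent_space (K : numFieldType) N (M0 A : 'M[K]_N) :
  M0^T = M0 -> A^T = A ->
  (forall p (U : 'M_(N, p)), M0 *m U = 0 -> U^T *m A *m U = 0) ->
  exists W, W^T *m M0 + M0 *m W = A.
Proof.
move=> symM0 symA kerA; pose G := pinvmx M0; pose Q := G *m M0.
have M0Q : M0 *m Q = M0 by rewrite mulmxA mulmxKpV.
have M0G : M0 *m G^T = Q^T by rewrite [RHS]trmx_mul symM0.
have [V QV VAV] : exists2 V, Q + V = 1%:M & V^T *m A *m V = 0.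
  exists (1%:M - Q); first by rewrite addrC subrK.
  by apply: kerA; rewrite mulmxBr mulmx1 M0Q subrr.
have half : (2^-1 : K) + 2^-1 = 1 by rewrite [RHS]splitr mul1r.
exists (G^T *m (A *m V + 2^-1 *: (A *m Q))); set W := G^T *m _.
have M0W : M0 *m W = Q^T *m A *m V + 2^-1 *: (Q^T *m A *m Q).
  by rewrite mulmxA M0G mulmxDr -scalemxAr !mulmxA.
have WM0 : W^T *m M0 = V^T *m A *m Q + 2^-1 *: (Q^T *m A *m Q).
  rewrite -[in LHS]symM0 -trmx_mul M0W linearD linearZ /=.
  by rewrite !trmx_mul !trmxK symA !mulmxA.
have defA : A = (Q + V)^T *m A *m (Q + V) by rewrite QV trmx1 mul1mx mulmx1.
have trQV : (Q + V)^T = Q^T + V^T by rewrite linearD.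
rewrite WM0 M0W addrACA -scalerDl half scale1r [RHS]defA trQV !mulmxDl !mulmxDr VAV.
by rewrite addr0 [RHS]addrC -addrA [X in _ + X = _]addrC.
Qed.

Section SpanningProducts.
Variables (K : numFieldType) (n j : nat).
Hypothesis le_jn : ('C(j.+1, 2) <= n)%N.

Lemma sorted_pair_slot : exists slot : sorted_pair j -> 'I_n, injective slot.
Proof.
have le_card : (#|{: sorted_pair j}| <= n)%N by rewrite card_sorted_pair.
exists (fun t => widen_ord le_card (enum_rank t)) => t t' /(congr1 val) /= eq_t.
by apply: enum_rank_inj; apply: val_inj.
Qed.

Lemma mul_delta_diag (d : 'rV[K]_n) (a : 'I_j) (i : 'I_n) :
  delta_mx a i *m diag_mx d = d ord0 i *: delta_mx a i.
Proof.
apply/matrixP => b i'; rewrite mul_mx_diag !mxE mulrC.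
by case: eqP => [_|_]; case: eqP => [->|_]; rewrite ?mulr0.
Qed.

(** Slots are distinct, so only equal indices [t] contribute to the product. *)
Lemma mul_delta_slots (slot : sorted_pair j -> 'I_n) (al be : sorted_pair j -> 'I_j)
    (d : 'rV[K]_n) : injective slot ->
  (\sum_t delta_mx (slot t) (al t))^T *m diag_mx d *m
    (\sum_t delta_mx (slot t) (be t))
  = \sum_t d ord0 (slot t) *: delta_mx (al t) (be t).
Proof.
move=> inj_slot; have -> : (\sum_t delta_mx (slot t) (al t) : 'M[K]_(n, j))^T =
    \sum_t delta_mx (al t) (slot t).
  by rewrite raddf_sum; apply: eq_bigr => t _; rewrite /= trmx_delta.
rewrite mulmx_suml mulmx_suml.
apply: eq_bigr => t _; rewrite mulmx_sumr (bigD1 t) //= big1 ?addr0.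
  by rewrite mul_delta_diag -scalemxAl mul_delta_mx.
move=> t' neq_t; rewrite mul_delta_diag -scalemxAl mul_delta_mx_0 ?scaler0 //.
by rewrite (inj_eq inj_slot) eq_sym.
Qed.

(** The rows of [P] and [Q] at a slot attached to [a <= b] are the basis vectors
    [e_a] and [e_b]; as linear forms their product is the monomial [x_a x_b], and the
    rows at the other slots are zero. Every pair [(b, b)] has a slot, which makes
    the diagonal matrix [Q^T Q] invertible. *)
Lemma spanning_products : exists P Q : 'M[K]_(n, j),
  Q^T *m Q \in unitmx /\
  forall S, S^T = S -> exists d,
    P^T *m diag_mx d *m Q + Q^T *m diag_mx d *m P = S.
Proof.
have [slot inj_slot] := sorted_pair_slot.
pose fst_ix (t : sorted_pair j) := (val t).1.
pose snd_ix (t : sorted_pair j) := (val t).2.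
pose P : 'M[K]_(n, j) := \sum_t delta_mx (slot t) (fst_ix t).
pose Q : 'M[K]_(n, j) := \sum_t delta_mx (slot t) (snd_ix t).
exists P, Q; split=> [|S symS].
  have -> : Q^T *m Q = diag_mx (\row_b #|[set t | snd_ix t == b]|%:R).
    rewrite -[Q^T]mulmx1 -diag_const_mx mul_delta_slots //.
    apply/matrixP => a b; rewrite summxE !mxE.
    under eq_bigr => t _ do rewrite !mxE mul1r.
    have [<-|neq_ab] := eqVneq a b.
      rewrite mulr1n -sum1_card natr_sum [RHS]big_mkcond /=; apply: eq_bigr => t _.
      by rewrite inE eq_sym andbb; case: eqP.
    by rewrite mulr0n big1 // => t _; case: eqP => //= <-; rewrite eq_sym (negPf neq_ab).
  rewrite unitmxE det_diag unitfE; apply/prodf_neq0 => b _; rewrite mxE pnatr_eq0.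
  rewrite -lt0n; apply/card_gt0P.
  by exists (exist _ (b, b) (leqnn b) : sorted_pair j); rewrite inE.
(* On the diagonal, both products contribute to the same entry. *)
pose c t : K := S (fst_ix t) (snd_ix t) / (if fst_ix t == snd_ix t then 2 else 1).
pose d : 'rV[K]_n := \row_i \sum_t (slot t == i)%:R * c t.
have d_slot t : d ord0 (slot t) = c t.
  rewrite mxE (bigD1 t) //= eqxx mul1r big1 ?addr0 // => t' /negPf neq_t.
  by rewrite (inj_eq inj_slot) neq_t mul0r.
exists d; rewrite !mul_delta_slots //; apply/matrixP.
under eq_bigr do rewrite d_slot; under [X in _ + X]eq_bigr do rewrite d_slot.
suff le_case (a b : 'I_j) : (a <= b)%N ->
    (\sum_t c t *: delta_mx (fst_ix t) (snd_ix t) +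
     \sum_t c t *: delta_mx (snd_ix t) (fst_ix t)) a b = S a b.
  move=> a b; have [/le_case//|lt_ba] := leqP a b.
  have -> : S a b = S b a by have /matrixP/(_ b a) := symS; rewrite mxE.
  rewrite -(le_case b a (ltnW lt_ba)) [LHS]mxE [RHS]mxE addrC !summxE.
  by congr (_ + _); apply: eq_bigr => t _; rewrite !mxE andbC.
move=> le_ab; rewrite mxE !summxE -big_split /=.
rewrite (bigD1 (exist _ (a, b) le_ab : sorted_pair j)) //= big1 ?addr0.
  rewrite !mxE /c /fst_ix /snd_ix /= !eqxx !andbT [b == a]eq_sym.
  have [<-|_] := eqVneq a b; last by rewrite divr1 mulr1 mulr0 addr0.
  by rewrite !mulr1 -splitr.
move=> t neq_t; have neq_ab : (a == fst_ix t) && (b == snd_ix t) = false.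
  apply: contraNF neq_t => /andP[/eqP eq_a /eqP eq_b].
  by apply/eqP/val_inj; rewrite /= eq_a eq_b -surjective_pairing.
have neq_ba : (a == snd_ix t) && (b == fst_ix t) = false.
  apply/negP => /andP[/eqP eq_a /eqP eq_b]; move/negbT: neq_ab.
  have eq_ab : a = b.
    by apply/val_inj/eqP; rewrite eqn_leq le_ab eq_a eq_b (valP t).
  by rewrite {1}eq_ab eq_b -{1}eq_a eq_ab eq_b !eqxx.
by rewrite !mxE neq_ab neq_ba !mulr0 addr0.
Qed.

End SpanningProducts.

(** Completing the square, the form of [model] is
    [(x, y) |-> |x + T y|^2 - H(y)], where [H] is the orthogonal projection with
    kernel the column space of [Q], and where [T] is chosen such that [T Q = - P].
    Its kernel is thus spanned by the columns of [col_mx P Q]. Moreover [T] vanishes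
    on the image of [H], so that the form is [- H] on vectors [(0, y)] with [y] in
    that image. *)
Section Model.
Variables (K : numFieldType) (n j : nat) (P Q : 'M[K]_(n, j)).
Hypothesis unitQ : Q^T *m Q \in unitmx.

Definition model_H : 'M[K]_n := 1%:M - Q *m invmx (Q^T *m Q) *m Q^T.
Definition model_T : 'M[K]_n := - (P *m invmx (Q^T *m Q) *m Q^T).
Definition model : 'M[K]_(n + n) :=
  block_mx 1%:M model_T model_T^T (model_T^T *m model_T - model_H).

Lemma model_H_sym : model_H^T = model_H.
Proof.
by rewrite linearB /= trmx1 !trmx_mul trmxK trmx_inv trmx_mul trmxK mulmxA.
Qed.

Lemma model_HQ : model_H *m Q = 0.
Proof. by rewrite mulmxBl mul1mx -!mulmxA mulVmx // mulmx1 subrr. Qed.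

Lemma model_TQ : model_T *m Q = - P.
Proof. by rewrite mulNmx -!mulmxA mulVmx // mulmx1. Qed.

Lemma model_HTt : model_H *m model_T^T = 0.
Proof.
by rewrite linearN /= trmx_mul trmxK mulmxN mulmxA model_HQ mul0mx oppr0.
Qed.

Lemma model_HH : model_H *m model_H = model_H.
Proof.
by rewrite [in X in _ *m X]/model_H mulmxBr mulmx1 !mulmxA model_HQ !mul0mx subr0.
Qed.

Lemma model_rank_H : (n - j <= \rank model_H)%N.
Proof.
rewrite leq_subLR -{1}(mxrank1 K n) -[1%:M](subrK (Q *m invmx (Q^T *m Q) *m Q^T)).
rewrite addnC (leq_trans (mxrank_add _ _)) // leq_add2l.
by rewrite -mulmxA (leq_trans (mxrankM_maxl _ _)) ?rank_leq_col.
Qed.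

Lemma model_sym : model^T = model.
Proof.
rewrite /model tr_block_mx trmx1 trmxK linearB /= trmx_mul trmxK.
by rewrite model_H_sym.
Qed.

Lemma model_kernelP p (U : 'M_(n + n, p)) :
  model *m U = 0 -> exists R, U = col_mx P Q *m R.
Proof.
rewrite -[U]vsubmxK; set u := usubmx U; set v := dsubmx U.
rewrite mul_block_col mul1mx => /eqP; rewrite col_mx_eq0 => /andP[/eqP eq1 /eqP eq2].
have defu : u = - (model_T *m v) by apply/eqP; rewrite -addr_eq0 eq1.
have Hv : model_H *m v = 0.
  apply/eqP; move: eq2; rewrite defu mulmxBl mulmxN mulmxA addrA addNr add0r.
  by move/eqP; rewrite oppr_eq0.
have defv : v = Q *m (invmx (Q^T *m Q) *m Q^T *m v).
  by apply/eqP; rewrite -subr_eq0 !mulmxA -{1}[v]mul1mx -mulmxBl Hv.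
exists (invmx (Q^T *m Q) *m Q^T *m v); rewrite mul_col_mx -defv; congr col_mx.
by rewrite defu {1}defv !mulmxA model_TQ !mulNmx opprK.
Qed.

Lemma model_mul_kernel : model *m col_mx P Q = 0.
Proof.
rewrite mul_block_col mul1mx model_TQ subrr mulmxBl -mulmxA model_TQ model_HQ.
by rewrite subr0 mulmxN subrr col_mx0.
Qed.

Lemma model_rank : (\rank model <= n + n - j)%N.
Proof.
have rkZ : (j <= \rank (col_mx P Q))%N.
  rewrite -[X in (X <= _)%N](mxrank_unit unitQ) -[Q^T *m Q]add0r -[0](mul0mx j P) -mul_row_col.
  exact: mxrankM_maxr.
have := mulmx0_rank_max model_mul_kernel => le_rk.
by rewrite leq_subRL ?(leq_trans rkZ) ?rank_leq_row // (leq_trans _ le_rk) // addnC leq_add2l.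
Qed.

End Model.

Lemma quadratic_form_bound (R : realFieldType) n (E : 'M[R]_n) (x : 'rV_n) c :
  (forall a b, `|E a b| <= c) ->
  `|(x *m E *m x^T) ord0 ord0| <= c * n%:R * (x *m x^T) ord0 ord0.
Proof.
move=> leE.
have -> : (x *m E *m x^T) ord0 ord0 = \sum_b \sum_a x ord0 a * E a b * x ord0 b.
  by rewrite mxE; apply: eq_bigr => b _; rewrite !mxE mulr_suml.
have -> : c * n%:R * (x *m x^T) ord0 ord0 =
    \sum_b \sum_a c * (x ord0 a ^+ 2 + x ord0 b ^+ 2) / 2.
  have -> : (x *m x^T) ord0 ord0 = \sum_a x ord0 a ^+ 2.
    by rewrite mxE; apply: eq_bigr => a _; rewrite mxE expr2.
  under [RHS]eq_bigr do rewrite -mulr_suml -mulr_sumr big_split /= sumr_const card_ord.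
  rewrite -mulr_suml -mulr_sumr big_split /= sumr_const card_ord sumrMnl.
  by rewrite -mulr_natr; field.
rewrite (le_trans (ler_norm_sum _ _ _)) // ler_sum // => b _.
rewrite (le_trans (ler_norm_sum _ _ _)) // ler_sum // => a _.
rewrite !normrM mulrAC; set u := `|x _ a|; set v := `|x _ b|.
have c_ge0 : 0 <= c by apply: le_trans (leE a b).
rewrite -[x _ a ^+ 2]real_normK ?num_real // -[x _ b ^+ 2]real_normK ?num_real //.
rewrite -/u -/v (@le_trans _ _ (u * v * c)) //.
  by rewrite ler_wpM2l ?mulr_ge0 ?normr_ge0.
have : 0 <= c * (u - v) ^+ 2 by rewrite mulr_ge0 ?sqr_ge0.
nra.
Qed.

(** The form of [M] is positive definite on the first block of coordinates, and
    negative definite on the image of [H] in the second block, because these are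
    perturbations of the identity and of minus the identity. A vector of the kernel of
    [M] lying in the sum of these two spaces is zero, whatever the off-diagonal
    blocks: the two forms take the same value on its components. So [M] is
    injective on a space of dimension at least [2n - j]. *)
Lemma model_rank_stable (R : realFieldType) n j (P Q : 'M[R]_(n, j))
    (M : 'M[R]_(n + n)) : Q^T *m Q \in unitmx -> M^T = M ->
  (forall a b, `|ulsubmx M a b - ulsubmx (model P Q) a b| <= (2 * n.+1)%:R^-1) ->
  (forall a b, `|drsubmx M a b - drsubmx (model P Q) a b| <= (2 * n.+1)%:R^-1) ->
  (n + n - j <= \rank M)%N.
Proof.
move=> unitQ symM near_ul near_dr.
pose H := model_H Q; pose V : 'M[R]_(n + n) := block_mx 1%:M 0 0 H.
have rkV : (n + n - j <= \rank V)%N.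
  rewrite /V rank_diag_block_mx mxrank1 -addnBA ?leq_add2l ?model_rank_H //.
  by rewrite -(mxrank_unit unitQ) (leq_trans (mxrankM_maxr _ _)) ?rank_leq_row.
suff capV0 : (V :&: kermx M)%MS = 0.
  apply: leq_trans rkV _; rewrite -(mxrank_mul_ker V M) capV0 mxrank0 addn0.
  exact: mxrankM_maxr.
apply/eqP; rewrite -submx0; apply/rV_subP => _ /[!sub_capmx] /andP[/submxP[u ->]].
move/sub_kermxP; pose x := lsubmx u; pose y := rsubmx u *m H.
have -> : u *m V = row_mx x y.
  by rewrite -{1}[u]hsubmxK mul_row_block !mulmx0 mulmx1 addr0 add0r.
have yH : y *m H = y by rewrite -mulmxA model_HH.
have yTt : y *m (model_T P Q)^T = 0 by rewrite -mulmxA model_HTt // mulmx0.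
clearbody x y; pose A := ulsubmx M; pose B := ursubmx M; pose C := drsubmx M.
have -> : M = block_mx A B B^T C by rewrite /B trmx_ursub symM submxK.
rewrite mul_row_block => /eqP; rewrite row_mx_eq0 => /andP[/eqP eqA /eqP eqC].
(* Pairing the two block equations with [x] and [y] eliminates [B]. *)
have eq_form : (x *m A *m x^T) ord0 ord0 = (y *m C *m y^T) ord0 ord0.
  have -> : x *m A *m x^T = (y *m C *m y^T)^T; last by rewrite mxE.
  have -> : x *m A = - (y *m B^T) by apply/eqP; rewrite -addr_eq0 eqA.
  have -> : y *m C = - (x *m B) by apply/eqP; rewrite -addr_eq0 addrC eqC.
  by rewrite !mulNmx linearN /= !trmx_mul trmxK mulmxA.
have c_bound : (2 * n.+1)%:R^-1 * n%:R <= 2^-1 :> R.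
  rewrite natrM invfM -mulrA ler_piMr ?invr_ge0 // mulrC ler_pdivrMr ?ltr0n //.
  by rewrite mul1r ler_nat.
have sq_ge0 p (z : 'rV[R]_p) : 0 <= (z *m z^T) ord0 ord0.
  by rewrite mxE sumr_ge0 // => a _; rewrite mxE -expr2 sqr_ge0.
have sq_eq0 p (z : 'rV[R]_p) : (z *m z^T) ord0 ord0 <= 0 -> z = 0.
  move=> z_le0; have : (z *m z^T) ord0 ord0 == 0 by rewrite eq_le z_le0 sq_ge0.
  rewrite mxE psumr_eq0 => [/allP z0|a _]; last by rewrite mxE -expr2 sqr_ge0.
  apply/rowP => a; have := z0 a; rewrite mem_index_enum !mxE -expr2 sqrf_eq0.
  by move=> /(_ isT)/eqP.
have boundA : (x *m x^T) ord0 ord0 <= 2 * (x *m A *m x^T) ord0 ord0.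
  pose E := A - 1%:M.
  have leE a b : `|E a b| <= (2 * n.+1)%:R^-1.
    by have := near_ul a b; rewrite /model block_mxKul !mxE.
  have -> : A = 1%:M + E by rewrite addrC subrK.
  have := quadratic_form_bound x leE; clearbody E.
  rewrite mulmxDr mulmx1 mulmxDl [(x *m x^T + _) ord0 ord0]mxE ler_norml => /andP[le_E _].
  have := ler_wpM2r (sq_ge0 _ x) c_bound.
  by move: le_E; set cX := _^-1 * _ * _; lra.
have boundC : 2 * (y *m C *m y^T) ord0 ord0 <= - (y *m y^T) ord0 ord0.
  pose C0 := (model_T P Q)^T *m model_T P Q - H; pose E := C - C0.
  have leE a b : `|E a b| <= (2 * n.+1)%:R^-1.
    by have := near_dr a b; rewrite /model block_mxKdr !mxE.
  have -> : C = E + C0 by rewrite subrK.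
  have := quadratic_form_bound y leE; clearbody E.
  have -> : y *m (E + C0) *m y^T = y *m E *m y^T - y *m y^T.
    rewrite mulmxDr mulmxDl /C0 mulmxBr mulmxA yTt mul0mx.
    by rewrite sub0r yH mulNmx.
  rewrite [(_ - y *m y^T) ord0 ord0]mxE [(- (y *m y^T)) ord0 ord0]mxE ler_norml.
  move=> /andP[_ le_E]; have := ler_wpM2r (sq_ge0 _ y) c_bound.
  by move: le_E; set cY := _^-1 * _ * _; lra.
have x2 := sq_ge0 _ x; have y2 := sq_ge0 _ y; rewrite eq_form in boundA.
have x0 : x = 0 by apply: sq_eq0; lra.
have y0 : y = 0 by apply: sq_eq0; lra.
by rewrite x0 y0 row_mx0 sub0mx.
Qed.

(** * Density of low completion rank *)

(** For every direction [y] there is a tangent vector [N0 + D] to the matrices of rank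
    at most [2n - j] at [model P Q] with specified part [y]: the free entries [D] are
    chosen to cancel the form of [N0] on the kernel of the model. The matrices
    [(1 + e W)^T *m model P Q *m (1 + e W)] then form a curve with this velocity and
    of bounded rank. *)
Lemma low_rank_dense (K : numFieldType) n j m (pos : 'I_m -> 'I_(n + n) * 'I_(n + n))
    (P Q : 'M[K]_(n, j)) (p : {mpoly K[m]}) (eps : K) :
  (forall k i, pos k != (lshift n i, rshift n i) /\ pos k != (rshift n i, lshift n i)) ->
  (forall Y : 'rV[K]_m, exists2 M, M^T = M & entries_at pos M = Y) ->
  Q^T *m Q \in unitmx ->
  (forall S, S^T = S -> exists d, P^T *m diag_mx d *m Q + Q^T *m diag_mx d *m P = S) ->
  p != 0 -> 0 < eps ->
  exists M, [/\ M^T = M, (\rank M <= n + n - j)%N,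
    forall a b, `|M a b - model P Q a b| <= eps & p.[: entries_at pos M ] != 0].
Proof.
move=> pos_free pos_sym unitQ spanPQ p_neq0 eps_gt0.
pose M0 := model P Q.
have [y yP] := mpoly_curve (fun k => entries_at pos M0 ord0 k) p_neq0.
have [N0 symN0 N0y] := pos_sym (\row_k y k).
pose Z := col_mx P Q.
have [d dP] : exists d, P^T *m diag_mx d *m Q + Q^T *m diag_mx d *m P = - (Z^T *m N0 *m Z).
  by apply: spanPQ; rewrite linearN /= !trmx_mul trmxK symN0 mulmxA.
pose D := block_mx 0 (diag_mx d) (diag_mx d) 0 : 'M_(n + n).
have symD : D^T = D by rewrite /D tr_block_mx !trmx0 tr_diag_mx.
have ZDZ : Z^T *m D *m Z = - (Z^T *m N0 *m Z).
  rewrite -dP /Z /D tr_col_mx mul_row_block !mulmx0 addr0 add0r mul_row_col.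
  by rewrite addrC.
have Dpos k : D (pos k).1 (pos k).2 = 0.
  have := pos_free k; case: (pos k) => a b /=.
  rewrite /D; case: (split_ordP a) => a' ->; case: (split_ordP b) => b' -> free.
  - by rewrite block_mxEul mxE.
  - rewrite block_mxEur mxE; case: eqP => // eq_ab; have [] := free a'.
    by rewrite eq_ab eqxx.
  - rewrite block_mxEdl mxE; case: eqP => // eq_ab; have [_] := free a'.
    by rewrite eq_ab eqxx.
  - by rewrite block_mxEdr mxE.
have symM0 : M0^T = M0 by apply: model_sym.
have [W WP] : exists W, W^T *m M0 + M0 *m W = N0 + D.
  apply: rank_tangent_space; rewrite ?linearD /= ?symN0 ?symD //.
  move=> q U /(model_kernelP unitQ)[S ->]; rewrite -/Z trmx_mul.
  have -> : S^T *m Z^T *m (N0 + D) *m (Z *m S) =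
      S^T *m (Z^T *m N0 *m Z + Z^T *m D *m Z) *m S.
    by rewrite -mulmxDl -mulmxDr !mulmxA.
  by rewrite ZDZ subrr mulmx0 mul0mx.
pose W2 := W^T *m M0 *m W.
pose M e := (1%:M + e *: W)^T *m M0 *m (1%:M + e *: W).
have ME e : M e = M0 + e *: (N0 + D) + e ^+ 2 *: W2.
  have -> : M e = (1%:M + e *: W^T) *m M0 *m (1%:M + e *: W).
    by congr (_ *m _ *m _); rewrite linearD linearZ /= trmx1.
  rewrite mulmxDl mul1mx -scalemxAl mulmxDl !mulmxDr !mulmx1 -!scalemxAr -WP.
  by rewrite -scalemxAl scalerA -expr2 scalerDr !addrA [M0 + _ + _]addrAC.
have [g g_neq0 gP] := yP (fun k => entries_at pos W2 ord0 k).
pose B := \sum_a \sum_b (`|(N0 + D) a b| + `|W2 a b|).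
have B_ge0 : 0 <= B by do 2![apply: sumr_ge0 => ? _]; rewrite addr_ge0.
have leB a b : `|(N0 + D) a b| + `|W2 a b| <= B.
  rewrite /B (bigD1 a) //= (bigD1 b) //= -addrA lerDl.
  by rewrite addr_ge0 ?sumr_ge0 // => *; rewrite ?sumr_ge0 // => *; rewrite addr_ge0.
(* For [0 < e <= e0] both [e * B <= eps] and [e <= 1] hold; among these [e], one
   is not a root of [g]. *)
pose e0 := eps / (B + eps + 1).
have den_gt0 : 0 < B + eps + 1 by rewrite ltr_wpDl // addr_ge0 // ltW.
have [|e /andP[e_gt0 le_e] ge_neq0] := poly_nonroot g_neq0 (_ : 0 < e0).
  by rewrite divr_gt0.
have le_eB : e * B <= eps.
  have : e * (B + eps + 1) <= eps by rewrite -ler_pdivlMr.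
  by apply: le_trans; rewrite ler_wpM2l ?(ltW e_gt0) // -addrA lerDl addr_ge0 ?ltW.
have le_e1 : e <= 1.
  apply: le_trans le_e _; rewrite ler_pdivrMr // mul1r addrAC lerDr addr_ge0 //.
exists (M e); split.
- by rewrite /M !trmx_mul trmxK symM0 mulmxA.
- apply: leq_trans (model_rank P unitQ); apply: leq_trans (mxrankM_maxl _ _) _.
  exact: mxrankM_maxr.
- move=> a b; have diffE (X1 X2 X3 : 'M[K]_(n + n)) c2 c3 :
      (X1 + c2 *: X2 + c3 *: X3) a b - X1 a b = c2 * X2 a b + c3 * X3 a b.
    by rewrite !mxE; ring.
  rewrite ME diffE; apply: le_trans le_eB.
  apply: le_trans (ler_normD _ _) _; rewrite !normrM !(gtr0_norm e_gt0).
  apply: (@le_trans _ _ (e * (`|(N0 + D) a b| + `|W2 a b|))).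
    by rewrite [leRHS]mulrDr lerD2l ler_wpM2r // ler_piMr // ltW.
  by rewrite ler_wpM2l ?leB ?ltW.
rewrite -gP in ge_neq0; apply: contraNneq ge_neq0 => <-; apply/eqP/meval_eq => k.
have y_k : y k = N0 (pos k).1 (pos k).2.
  by have /rowP/(_ k) := N0y; rewrite !mxE.
have entE X : entries_at pos X ord0 k = X (pos k).1 (pos k).2 by rewrite mxE.
have sumE (X1 X2 X3 X4 : 'M[K]_(n + n)) c2 c3 a b :
    (X1 + c2 *: (X2 + X3) + c3 *: X4) a b
    = X1 a b + c2 * (X2 a b + X3 a b) + c3 * X4 a b by rewrite !mxE.
by rewrite !entE ME sumE Dpos addr0 y_k.
Qed.

(** * The cocktail party graph with loops *)

Lemma mxrank_mxsub (K : fieldType) m n m' n' (f : 'I_m' -> 'I_m)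
    (g : 'I_n' -> 'I_n) (M : 'M[K]_(m, n)) :
  (\rank (mxsub f g M) <= \rank M)%N.
Proof.
have -> : mxsub f g M = rowsub f (colsub g M) by apply/matrixP => i j; rewrite !mxE.
rewrite (leq_trans (mxrankS (rowsub_sub _ _))) // -mxrank_tr trmx_mxsub.
by rewrite (leq_trans (mxrankS (rowsub_sub _ _))) ?mxrank_tr.
Qed.

Lemma rank_le_completable_reindex (K : fieldType) m N N' (pos : 'I_m -> 'I_N * 'I_N)
    (s : 'I_N -> 'I_N') (s' : 'I_N' -> 'I_N) (X : 'rV[K]_m) r :
  cancel s s' -> rank_le_completable pos r X ->
  rank_le_completable (fun k => (s (pos k).1, s (pos k).2)) r X.
Proof.
move=> sK [M [symM <- rkM]]; exists (mxsub s' s' M); split.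
- by rewrite trmx_mxsub symM.
- by apply/rowP => k; rewrite !mxE !sK.
- exact: leq_trans (mxrank_mxsub _ _ _) rkM.
Qed.

Lemma rank_le_completable_sub (K : fieldType) m N N' (pos : 'I_m -> 'I_N * 'I_N)
    (s : 'I_N -> 'I_N') (X : 'rV[K]_m) r :
  rank_le_completable (fun k => (s (pos k).1, s (pos k).2)) r X ->
  rank_le_completable pos r X.
Proof.
move=> [M [symM <- rkM]]; exists (mxsub s s M); split.
- by rewrite trmx_mxsub symM.
- by apply/rowP => k; rewrite !mxE.
- exact: leq_trans (mxrank_mxsub _ _ _) rkM.
Qed.

(** Distinct edges are distinct unordered pairs, so that no two of them prescribe the
    same entry or mirror entries. *)
Lemma edge_pos_symmetric (K : fieldType) (G : sgraph) (Y : partial_matrix K G) :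
  exists2 M, M^T = M & entries_at (@edge_pos G) M = Y.
Proof.
pose entry (x y : G) := if [pick k | enum_val k == [set x; y]%SET] is Some k
  then Y ord0 k else 0.
exists (\matrix_(a, b) entry (enum_val a) (enum_val b)).
  by apply/matrixP => a b; rewrite !mxE /entry finset.setUC.
apply/rowP => k; rewrite !mxE !enum_rankK /entry.
case: pickP => [k' /eqP|/(_ k)]; last by rewrite edge_endsE eqxx.
by rewrite -edge_endsE => /enum_val_inj ->.
Qed.

Section CocktailParty.

Definition two_loops : sgraph := gunion looped_vertex looped_vertex.

Definition side (x : two_loops) : bool := if x is inl _ then false else true.

(** The vertices of the join, labelled by the number of their copy and their side
    in it. The copy added last by the iteration has the largest number. *)
Fixpoint part (k : nat) : iter k (gjoin two_loops) two_loops -> nat * bool :=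
  match k with
  | 0 => fun x => (0, side x)
  | k'.+1 => fun x => match x with inl y => (k, side y) | inr z => part z end
  end.

Lemma side_inj : injective side.
Proof. by case=> [[]|[]] [[]|[]]. Qed.

Lemma part_le k (x : iter k (gjoin two_loops) two_loops) : ((part x).1 <= k)%N.
Proof. by elim: k x => //= k IHk [y|z] //=; apply: leqW. Qed.

Lemma part_inj k : injective (@part k).
Proof.
elim: k => [|k IHk] x y; first by case=> /side_inj.
case: x y => [x|x] [y|y] /=.
- by case=> /side_inj ->.
- by move=> eq_xy; have := part_le y; rewrite -eq_xy ltnn.
- by move=> eq_xy; have := part_le x; rewrite eq_xy ltnn.
- by move=> /IHk ->.
Qed.

Lemma adj_part k (x y : iter k (gjoin two_loops) two_loops) :
  adj x y = (part x == part y) || ((part x).1 != (part y).1).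
Proof.
elim: k x y => [|k IHk] x y; first by case: x y => [[]|[]] [[]|[]].
case: x y => [x|x] [y|y] /=.
- by rewrite xpair_eqE !eqxx orbF; case: x y => [[]|[]] [[]|[]].
- by rewrite orbC neq_ltn ltnS part_le orbT.
- by rewrite orbC neq_ltn ltnS part_le.
- exact: IHk.
Qed.

Lemma card_join_copies k : #|vert (iter k (gjoin two_loops) two_loops)| = (2 * k.+1)%N.
Proof.
elim: k => [|k IHk]; first by rewrite card_sum card_unit.
by rewrite [LHS]card_sum IHk card_sum card_unit; lia.
Qed.

Lemma cocktail_party_vertices n : (1 <= n)%N ->
  exists2 v : 'I_n * bool -> G_ n, bijective v &
    forall p q, adj (v p) (v q) = (p == q) || (p.1 != q.1).
Proof.
case: n => // k _; pose u (x : G_ k.+1) : 'I_k.+1 * bool := (inord (part x).1, (part x).2).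
have valu x : val (u x).1 = (part x).1 by rewrite /= inordK // ltnS part_le.
have inj_u : injective u.
  move=> x y eq_u; apply: (@part_inj k); rewrite [LHS]surjective_pairing.
  by rewrite [RHS]surjective_pairing -!valu eq_u; case: eq_u => _ ->.
have [v uK vK] : bijective u.
  apply: inj_card_bij => //.
  by rewrite card_prod card_ord card_bool /G_ /join_copies /= card_join_copies mulnC.
exists v => [|p q]; first by exists u.
rewrite [LHS]adj_part -!valu !vK; congr (_ || _).
by rewrite -[in RHS](vK p) -[in RHS](vK q) (inj_eq inj_u) (inj_eq (@part_inj k)).
Qed.

End CocktailParty.

(** Edges are counted by an injection of triples [(i, j, c)]. For [i <= j] the image is
    the edge between the vertices of side [c] in copies [i] and [j], and for [j < i]
    an edge between vertices of different sides: each of the four edges between two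
    copies, and each of the two loops of a copy, is hit once. *)
Lemma card_edges_cocktail_party n : (1 <= n)%N -> (2 * n * n <= #|edges (G_ n)|)%N.
Proof.
move=> /cocktail_party_vertices[v /bij_inj inj_v adj_v].
pose e (t : 'I_n * 'I_n * bool) : {set G_ n} :=
  [set v (t.1.1, t.2); v (t.1.2, t.2 (+) (t.1.2 < t.1.1)%N)]%SET.
have inj_e : injective e.
  move=> [[i j] c] [[i' j'] c'] /set2_eq[] [/inj_v[/= eq_i eq_c] /inj_v[/= eq_j eq_s]].
    by rewrite eq_i eq_c eq_j.
  move: eq_c eq_s; rewrite -{}eq_i -{}eq_j.
  by case: ltngtP => [_|_|/val_inj ->]; case: c c' => [] [].
have -> : (2 * n * n = #|{: 'I_n * 'I_n * bool}|)%N.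
  by rewrite !card_prod card_ord card_bool; lia.
rewrite -cardsT -(card_imset _ inj_e); apply/subset_leq_card/fintype.subsetP.
move=> _ /imsetP[[[i j] c] _ ->]; apply/imsetP.
exists (v (i, c), v (j, c (+) (j < i)%N)) => //=.
rewrite inE /= adj_v xpair_eqE /=; case: eqVneq => [->|//].
by rewrite ltnn addbF eqxx.
Qed.

Section Positions.
Variable n : nat.
Hypothesis n_gt0 : (1 <= n)%N.
Local Notation m := #|edges (G_ n)|.

(** Vertices are put in an order where the vertices [lshift n i] and [rshift n i] are
    the two sides of copy [i]. Then the positions of the edges avoid [n] entries of the
    off-diagonal blocks, and fill both diagonal blocks. *)
Lemma cocktail_party_positions : exists pos : 'I_m -> 'I_(n + n) * 'I_(n + n),
  [/\ forall k i, pos k != (lshift n i, rshift n i) /\ pos k != (rshift n i, lshift n i),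
      forall i j, exists k, pos k = (lshift n i, lshift n j) \/ pos k = (lshift n j, lshift n i),
      forall i j, exists k, pos k = (rshift n i, rshift n j) \/ pos k = (rshift n j, rshift n i),
      forall (K : fieldType) (Y : 'rV[K]_m), exists2 M, M^T = M & entries_at pos M = Y &
      forall (K : fieldType) (X : 'rV[K]_m) r,
        rank_le_completable (@edge_pos (G_ n)) r X <-> rank_le_completable pos r X].
Proof.
have [v [u vK uK] adj_v] := cocktail_party_vertices n_gt0.
pose s0 (p : 'I_n * bool) : 'I_(n + n) := if p.2 then rshift n p.1 else lshift n p.1.
pose s1 (a : 'I_(n + n)) : 'I_n * bool :=
  match split a with inl i => (i, false) | inr i => (i, true) end.
have s0K : cancel s0 s1.
  by case=> i [] /=; rewrite /s0 /s1 /= (unsplitK (inl i), unsplitK (inr i)).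
pose s (a : 'I_#|G_ n|) := s0 (u (enum_val a)).
pose s' (a : 'I_(n + n)) := enum_rank (v (s1 a)).
have sK : cancel s s' by move=> a; rewrite /s /s' s0K uK enum_valK.
pose pos k := (s (edge_pos k).1, s (edge_pos k).2).
have posE k : pos k = (s0 (u (edge_ends k).1), s0 (u (edge_ends k).2)).
  by rewrite /pos /s /edge_pos /= !enum_rankK.
have free k i c c' : pos k = (s0 (i, c), s0 (i, c')) -> c = c'.
  rewrite posE => -[/(can_inj s0K) e1 /(can_inj s0K) e2].
  have := edge_ends_adj k; rewrite -[(edge_ends k).1]uK -[(edge_ends k).2]uK e1 e2.
  by rewrite adj_v eqxx orbF => /eqP[].
have full c i j : exists k, pos k = (s0 (i, c), s0 (j, c)) \/ pos k = (s0 (j, c), s0 (i, c)).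
  have edge_ij : [set v (i, c); v (j, c)]%SET \in edges (G_ n).
    apply/imsetP; exists (v (i, c), v (j, c)) => //=.
    by rewrite inE /= adj_v xpair_eqE /= eqxx andbT orbN.
  exists (enum_rank_in edge_ij [set v (i, c); v (j, c)]%SET); rewrite posE.
  have := edge_endsE (enum_rank_in edge_ij [set v (i, c); v (j, c)]%SET).
  rewrite enum_rankK_in // => /set2_eq[[<- <-]|[<- <-]]; rewrite !vK; by [left|right].
exists pos; split.
- move=> k i; split; apply/eqP => pos_k; first by have := free k i false true pos_k.
  by have := free k i true false pos_k.
- exact: full false.
- exact: full true.
- move=> K Y; have [M symM MY] := edge_pos_symmetric Y.
  exists (mxsub s' s' M); first by rewrite trmx_mxsub symM.
  by rewrite -MY; apply/rowP => k; rewrite !mxE !sK.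
move=> K X r; split; first exact: rank_le_completable_reindex.
exact: rank_le_completable_sub.
Qed.

Lemma cocktail_party_low_rank_dense (K : numFieldType) j (p : {mpoly K[m]}) :
  ('C(j.+1, 2) <= n)%N -> p != 0 ->
  exists2 X, rank_le_completable (@edge_pos (G_ n)) (n + n - j) X & p.[: X ] != 0.
Proof.
move=> le_jn p_neq0; have [pos [free _ _ sym posP]] := cocktail_party_positions.
have [P [Q [unitQ spanPQ]]] := spanning_products K le_jn.
have [M [symM rkM _ pM]] := low_rank_dense free (sym K) unitQ spanPQ p_neq0 ltr01.
by exists (entries_at pos M) => //; apply/posP; exists M.
Qed.

Lemma cocktail_party_exact_rank_dense (R : realFieldType) j (p : {mpoly R[m]}) :
  ('C(j.+1, 2) <= n)%N -> p != 0 ->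
  exists2 X, min_rank_completable (@edge_pos (G_ n)) (n + n - j) X & p.[: X ] != 0.
Proof.
move=> le_jn p_neq0; have [pos [free full_l full_r sym posP]] := cocktail_party_positions.
have [P [Q [unitQ spanPQ]]] := spanning_products R le_jn.
have eps_gt0 : 0 < (2 * n.+1)%:R^-1 :> R by rewrite invr_gt0 ltr0n.
have [M [symM rkM nearM pM]] :=
  low_rank_dense free (sym R) unitQ spanPQ p_neq0 eps_gt0.
exists (entries_at pos M) => //; split; first by apply/posP; exists M.
move=> r' lt_r' /posP[M' [symM' eqM' rkM']].
have symE (A : 'M[R]_(n + n)) a b : A^T = A -> A a b = A b a.
  by move=> /matrixP/(_ b a); rewrite mxE.
have agree a b k : pos k = (a, b) \/ pos k = (b, a) -> M' a b = M a b.
  have /rowP/(_ k) := eqM'; rewrite !mxE => eqk.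
  by case=> pos_k; move: eqk; rewrite pos_k //= ?(symE M' b) // ?(symE M b).
suff: (n + n - j <= \rank M')%N by rewrite leqNgt (leq_ltn_trans rkM').
apply: (model_rank_stable unitQ symM') => a b.
  have ulE (A : 'M[R]_(n + n)) : ulsubmx A a b = A (lshift n a) (lshift n b).
    by rewrite !mxE.
  by have [k /agree M'ab] := full_l a b; rewrite !ulE M'ab.
have drE (A : 'M[R]_(n + n)) : drsubmx A a b = A (rshift n a) (rshift n b).
  by rewrite !mxE.
by have [k /agree M'ab] := full_r a b; rewrite !drE M'ab.
Qed.

(** The identity behind this count is
    [sym_rank_dim r + 'C(j.+1, 2) = 'C((2 * n).+1, 2) = 2 * n * n + n], for
    [r = 2 * n - j]. *)
Lemma cocktail_party_rank_lower_bound (K : fieldType) j :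
  (n < 'C(j.+1, 2))%N -> (j <= n + n)%N ->
  exists2 p : {mpoly K[m]}, p != 0 &
    forall X, rank_le_completable (@edge_pos (G_ n)) (n + n - j) X -> p.[: X ] = 0.
Proof.
move=> lt_nj le_j; have cardG : #|G_ n| = (n + n)%N.
  have [v bij_v _] := cocktail_party_vertices n_gt0.
  by rewrite -(bij_eq_card bij_v) card_prod card_ord card_bool; lia.
apply: rank_le_not_dense; first by rewrite cardG leq_subr.
apply: leq_trans (card_edges_cocktail_party n_gt0); rewrite /sym_rank_dim cardG subKn //.
set r := (n + n - j)%N; have r_j : (r + j = n + n)%N by rewrite subnK.
have := bin2D r.+1 j; rewrite addSn r_j mulSn.
have := triangular_double (n + n); have := binS j 1; rewrite bin1.
nia.
Qed.

End Positions.

(** * The generic and typical ranks *)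

(** Both bounds hold on the complement of the zeros of one polynomial. Uniqueness
    comes from the fact that two nonempty Zariski open sets meet. *)
Lemma complex_generic_rank (R : realType) n k : (1 <= n)%N ->
  ('C(k.+1, 2) <= n)%N -> (n < 'C(k.+2, 2))%N -> (k < n + n)%N ->
  is_sgcr R (G_ n) (n + n - k).
Proof.
move=> n_gt0 le_kn lt_nk lt_k; set s := (n + n - k)%N.
have rf := @rformula_rank_le R[i] #|G_ n| #|edges (G_ n)| (@edge_pos (G_ n)) s.
have [L nzL LP] := closed_definable_generic #|edges (G_ n)| rf.
have [p nzp pP] := cocktail_party_rank_lower_bound n_gt0 R[i] lt_nk lt_k.
have [X0 leX0 LX0] := cocktail_party_low_rank_dense n_gt0 le_kn nzL.
pose U : set 'rV[R[i]]_#|edges (G_ n)| := [set X | (L * p).[: X ] != 0]%classic.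
have Uopen : zariski_open U.
  exists [set L * p]%classic => X; split=> [UX|[_ -> //]].
  by exists (L * p).
have evE (g : {mpoly R[i][#|edges (G_ n)|]}) x : g.[: \row_k x k ] = g.@[x].
  by apply: meval_eq => k'; rewrite mxE.
have meetU (V : set 'rV[R[i]]_#|edges (G_ n)|) : zariski_open V -> (V !=set0)%classic ->
    (V `&` U !=set0)%classic.
  move=> [S SP] [Y /SP[q Sq qY]].
  have nzq : q != 0 by apply: contraNneq qY => ->; rewrite meval0.
  have [x xP] := mpoly_nonroot (mulf_neq0 nzq (mulf_neq0 nzL nzp)).
  exists (\row_k x k); move: xP; rewrite mevalM mulf_eq0 negb_or => /andP[qx Lpx]; split.
    by apply/SP; exists q; rewrite ?evE.
  by rewrite /U /= evE.
have UP X : U X -> completion_rank X s.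
  rewrite /U /= mevalM mulf_eq0 negb_or => /andP[LX pX]; apply/completion_rankP; split.
    by apply/rank_le_formulaP; apply: LP LX0 LX _; apply/rank_le_formulaP.
  move=> r' lt_r' /(rank_le_completableW (_ : (r' <= n + n - k.+1)%N)) le_X.
  by move: pX; rewrite pP ?eqxx //; apply: le_X; rewrite /s in lt_r'; lia.
have rank_uniq X a b : completion_rank (G := G_ n) (K := R[i]) X a ->
    completion_rank X b -> a = b.
  move=> [[M XM rkM] minM] [[N XN rkN] minN].
  have := minM N XN; have := minN M XM; rewrite rkN rkM => le_ba le_ab.
  by apply/eqP; rewrite eqn_leq le_ab.
split.
  exists U; split=> //; have [x xP] := mpoly_nonroot (mulf_neq0 nzL nzp).
  by exists (\row_k x k); rewrite /U /= evE.
move=> s' [V [Vopen Vne VP]]; have [X [VX UX]] := meetU V Vopen Vne.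
exact: rank_uniq (UP X UX) (VP X VX).
Qed.

Lemma real_typical_rank (R : realType) n j : (1 <= n)%N ->
  ('C(j.+1, 2) <= n)%N -> typical_rank R (G_ n) (n + n - j).
Proof.
move=> n_gt0 le_jn.
have rf := @rformula_rank_eq R #|G_ n| #|edges (G_ n)| (@edge_pos (G_ n)) (n + n - j).
have [L nzL LP] := real_definable_interior #|edges (G_ n)| rf.
have [X XP LX] := cocktail_party_exact_rank_dense n_gt0 le_jn nzL.
exists X; have := LP X LX; rewrite rank_eq_formulaP => /(_ XP).
by apply: filterS => Y /rank_eq_formulaP/completion_rankP.
Qed.

Lemma triangular_root n :
  exists2 k, ('C(k.+1, 2) <= n)%N & forall j, ('C(j.+1, 2) <= n)%N -> (j <= k)%N.
Proof.
have ex0 : exists j, ('C(j.+1, 2) <= n)%N by exists 0.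
have bound j : ('C(j.+1, 2) <= n)%N -> (j <= n)%N.
  by apply: leq_trans; rewrite binS bin1 leq_addl.
by case: (ex_maxnP ex0 bound) => k le_kn max_k; exists k.
Qed.

(** Both bounds on [n] together say that [(2k + 1)^2 <= 1 + 8n < (2k + 3)^2]. *)
Lemma floor_triangular_root (R : realType) n k :
  ('C(k.+1, 2) <= n)%N -> (n < 'C(k.+2, 2))%N ->
  Num.floor (2^-1 * (Num.sqrt (1 + 8 * n%:R) - 1) : R) = k%:Z.
Proof.
move=> le_kn lt_nk; set t := Num.sqrt _.
have t2 : t ^+ 2 = 1 + 8 * n%:R by rewrite sqr_sqrtr // addr_ge0 ?mulr_ge0 ?ler0n.
have t_ge0 : 0 <= t := sqrtr_ge0 _.
have lo : (k.+1%:R * k%:R <= 2 * n%:R :> R).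
  by rewrite -!natrM ler_nat -triangular_double leq_mul2l.
have hi : (2 * (n%:R + 1) <= k.+2%:R * k.+1%:R :> R).
  by rewrite natr1 -!natrM ler_nat -triangular_double leq_mul2l.
rewrite -natr1 in lo; rewrite -!natr1 in hi.
have k_ge0 : 0 <= k%:R :> R by apply: ler0n.
have lo_t : 2 * k%:R + 1 <= t.
  by rewrite -(@ler_pXn2r _ 2) ?nnegrE ?addr_ge0 ?mulr_ge0 // t2; nra.
have hi_t : t < 2 * k%:R + 3.
  by rewrite -(@ltr_pXn2r _ 2) ?nnegrE ?addr_ge0 ?mulr_ge0 // t2; nra.
apply: floor_def; rewrite rmorphD /= -!pmulrn.
by apply/andP; split; lra.
Qed.

Theorem theorem6p13 (R : realType) (n : nat) (hn : (1 <= n)%N) :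
  exists s : nat,
    [/\ is_sgcr R (G_ n) s,
        s%:Z = (2 * n)%:Z
               - Num.floor (2^-1 * (Num.sqrt (1 + 8 * n%:R) - 1) : R),
        exists k : nat,
          [/\ ('C(k + 1, 2) <= n)%N,
              forall j : nat, ('C(j + 1, 2) <= n)%N -> (j <= k)%N
            & s%:Z = (2 * n)%:Z - k%:Z]
      & forall r : nat, (s <= r <= 2 * n)%N -> typical_rank R (G_ n) r].
Proof.
have [k le_kn max_k] := triangular_root n.
have lt_nk : (n < 'C(k.+2, 2))%N by rewrite ltnNge; apply/negP => /max_k; rewrite ltnn.
have le_k : (k <= n)%N by apply: leq_trans le_kn; rewrite binS bin1 leq_addl.
have lt_k : (k < n + n)%N by lia.
have sE : (n + n - k)%:Z = (2 * n)%:Z - k%:Z by rewrite mul2n -addnn subzn // ltnW.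
exists (n + n - k)%N; split.
- exact: complex_generic_rank.
- by rewrite (floor_triangular_root R le_kn lt_nk).
- exists k; split=> //; first by rewrite addn1.
  by move=> j; rewrite addn1; apply: max_k.
move=> r /andP[le_r le_2n].
have -> : r = (n + n - (n + n - r))%N by lia.
apply: real_typical_rank => //; apply: leq_trans le_kn; apply: leq_bin2l; lia.
Qed.
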